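(* Let $I$ be a solution to the GKZ system for the Hesse pencil, i.e. $\theta_\alpha\circ\tilde{\mathcal{L}}_{\mathrm{PF}}\,I=0$, and denote the normalized period by $t_{\mathrm{GKZ}}=I/\omega_0$. Then near the infinity cusp $\alpha=0$ one has the Eichler integral expression $$t_{\mathrm{GKZ}}=a+b\tau+c\int^{\alpha}\frac{1}{v^2(1-v)}\,\frac{1}{W(v)}\,\omega_0(v)\bigl(\tau(\alpha)-\tau(v)\bigr)\,dv$$ for some constants $a,b,c$, and likewise, with $\tau$ as the variable (so that $\alpha$ and $\omega_0$ are regarded as functions on the $\tau$-upper half-plane), $$t_{\mathrm{GKZ}}=a+b\tau+c\int^{\tau}\bigl(1-\alpha(v)\bigr)\,\omega_0^3(v)\,(\tau-v)\,dv$$ for some constants $a,b,c$.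
   Context: The Hesse pencil is the family of elliptic curves $x^3+y^3+z^3-3\psi xyz=0$ in $\mathbb{P}^2$. Put $\alpha=\psi^{-3}$ and $\theta_\alpha=\alpha\frac{\partial}{\partial\alpha}$. In the coordinate $\alpha$ the Picard–Fuchs operator is $$\tilde{\mathcal{L}}_{\mathrm{PF}}=\theta_\alpha^2-\alpha\left(\theta_\alpha+\tfrac13\right)\left(\theta_\alpha+\tfrac23\right),$$ and the GKZ operator is, up to a constant multiple, $\theta_\alpha\circ\tilde{\mathcal{L}}_{\mathrm{PF}}$. Let $$\omega_0(\alpha)={}_2F_1\left(\tfrac13,\tfrac23;1;\alpha\right),\qquad \omega_1(\alpha)=\frac{i}{\sqrt3}\,{}_2F_1\left(\tfrac13,\tfrac23;1;1-\alpha\right),\qquad \tau=\frac{\omega_1}{\omega_0};$$ $\omega_0,\omega_1$ form a basis of solutions of $\tilde{\mathcal{L}}_{\mathrm{PF}}u=0$ near the infinity cusp $\alpha=0$, and (locally) $\tau$ can be used as coordinate in place of $\alpha$; the function $\alpha(\tau)$ is a Hauptmodul for the modular curve $\Gamma_0(3)\backslash\mathcal{H}^*$. $W(\alpha)=\omega_0'(\alpha)\omega_1(\alpha)-\omega_0(\alpha)\omega_1'(\alpha)$ is the Wronskian with respect to $\alpha$ (prime denotes $d/d\alpha$). Everything is considered locally, on a simply connected domain in a punctured neighborhood of $\alpha=0$ on which branches of these functions have been chosen. Lower limits of the integrals are arbitrary fixed base points; changing them only changes $a$ and $b$. *)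

(* Defs.v *)
From Stdlib Require Import Reals Factorial.
From Coquelicot Require Import Coquelicot.

Open Scope R_scope.

(** * Domains and paths in the complex plane *)

(* A path is a map [g : R -> C] of which only the restriction to [[0,1]] is
   used.  Continuity is asked on all of [R] (resp. [R * R]), which is no
   restriction: extend by constants outside [[0,1]] (resp. [[0,1] * [0,1]]). *)
Definition path_connected (D : C -> Prop) : Prop :=
  forall p q : C, D p -> D q ->
  exists g : R -> C,
    (forall t : R, continuous g t) /\
    (forall t : R, 0 <= t <= 1 -> D (g t)) /\
    g 0 = p /\ g 1 = q.

Definition null_homotopic_loops (D : C -> Prop) : Prop :=
  forall g : R -> C,
    (forall t : R, continuous g t) ->
    (forall t : R, 0 <= t <= 1 -> D (g t)) ->
    g 0 = g 1 ->
  exists h : R * R -> C,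
    (forall x : R * R, continuous h x) /\
    (forall s t : R, 0 <= s <= 1 -> 0 <= t <= 1 -> D (h (s, t))) /\
    (forall t : R, 0 <= t <= 1 -> h (0, t) = g t) /\
    (forall t : R, 0 <= t <= 1 -> h (1, t) = g 0) /\
    (forall s : R, 0 <= s <= 1 -> h (s, 0) = g 0 /\ h (s, 1) = g 0).

Definition is_domain (D : C -> Prop) : Prop :=
  (exists p : C, D p) /\ open D /\ path_connected D.

Definition simply_connected_domain (D : C -> Prop) : Prop :=
  is_domain D /\ null_homotopic_loops D.

Definition C1_path (D : C -> Prop) (g dg : R -> C) (p q : C) : Prop :=
  (forall t : R, 0 <= t <= 1 ->
     D (g t) /\
     @is_derive R_AbsRing C_R_NormedModule g t (dg t) /\
     continuous dg t) /\
  g 0 = p /\ g 1 = q.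

Definition is_path_integral (f : C -> C) (g dg : R -> C) (v : C) : Prop :=
  @is_RInt C_R_NormedModule (fun t : R => (f (g t) * dg t)%C) 0 1 v.

(** * Analytic functions and branches *)

Definition analytic_on (U : C -> Prop) (f : C -> C) : Prop :=
  forall z : C, U z ->
  exists (a : nat -> C) (r : R), 0 < r /\
    forall h : C, Cmod h < r ->
      @is_pseries C_AbsRing C_NormedModule a h (f (z + h)%C).

Definition same_germ (f g : C -> C) (p : C) : Prop :=
  locally p (fun z : C => f z = g z).

(* [is_branch X U f V g]: the function element [(V, g)] is obtained from
   [(U, f)] by finitely many direct analytic continuations, all of whose
   function elements live on subdomains of [X]. *)
Inductive is_branch (X U : C -> Prop) (f : C -> C) :
    (C -> Prop) -> (C -> C) -> Prop :=
| branch_start (V : C -> Prop) (g : C -> C) :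
    is_domain V -> (forall z : C, V z -> X z) -> analytic_on V g ->
    (exists p : C, U p /\ V p /\ same_germ f g p) ->
    is_branch X U f V g
| branch_continue (V V' : C -> Prop) (g g' : C -> C) :
    is_branch X U f V g ->
    is_domain V' -> (forall z : C, V' z -> X z) -> analytic_on V' g' ->
    (exists p : C, V p /\ V' p /\ same_germ g g' p) ->
    is_branch X U f V' g'.

(** * The Gauss hypergeometric series *)

Fixpoint pochhammer (a : R) (n : nat) : R :=
  match n with
  | O => 1
  | S m => pochhammer a m * (a + INR m)
  end.

(* The sum of the Gauss series; meaningful for [Cmod z < 1] only. *)
Definition hyp2F1 (a b c : R) (z : C) : C :=
  let u (n : nat) : C :=
    (RtoC (pochhammer a n * pochhammer b n / (pochhammer c n * INR (fact n)))
     * z ^ n)%C in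
  (Series (fun n => Re (u n)), Series (fun n => Im (u n))).

(** * The periods of the Hesse pencil near the infinity cusp *)

Definition omega0 (z : C) : C := hyp2F1 (1/3) (2/3) 1 z.

Definition omega1_series (z : C) : C :=
  (Ci / RtoC (sqrt 3) * hyp2F1 (1/3) (2/3) 1 (1 - z))%C.

(* The Gauss series in [omega0] converges on [Cmod z < 1], and the other
   singular point [1] of the Picard-Fuchs operator is on the boundary. *)
Definition punctured_disc (z : C) : Prop := 0 < Cmod z < 1.

(* [omega1_series] only makes sense for [Cmod (1 - z) < 1]; it has nontrivial
   monodromy around [0]. *)
Definition is_omega1 (D : C -> Prop) (omega1 : C -> C) : Prop :=
  is_branch punctured_disc
    (fun z : C => punctured_disc z /\ Cmod (1 - z)%C < 1) omega1_series
    D omega1.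

Definition wronskian (f g : C -> C) (z : C) : C :=
  (C_derive f z * g z - f z * C_derive g z)%C.

(** * Differential operators *)

Definition theta (f : C -> C) (z : C) : C := (z * C_derive f z)%C.

Definition theta_plus (k : R) (f : C -> C) (z : C) : C :=
  (theta f z + RtoC k * f z)%C.

Definition L_PF (f : C -> C) (z : C) : C :=
  (theta (theta f) z - z * theta_plus (1/3) (theta_plus (2/3) f) z)%C.

(* [C_derive] is total, so a solution of the third-order equation must
   explicitly be three times complex differentiable. *)
Definition GKZ_solution (D : C -> Prop) (f : C -> C) : Prop :=
  (forall z : C, D z ->
     ex_derive f z /\ ex_derive (theta f) z /\ ex_derive (theta (theta f)) z) /\
  (forall z : C, D z -> theta (L_PF f) z = 0).

(** * [tau] as a coordinate *)

(* [alpha] is a holomorphic local inverse of [tau] on a domain [T] of the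
   [tau]-plane.  [T] lies in the upper half-plane automatically, because
   [Im tau > 0] on [D]. *)
Definition tau_coordinate (D : C -> Prop) (tau : C -> C)
    (T : C -> Prop) (alpha : C -> C) : Prop :=
  is_domain T /\
  (forall v : C, T v -> D (alpha v) /\ tau (alpha v) = v /\ ex_derive alpha v).

(* Main.v *)
Require Import Defs.
From Stdlib Require Import Reals Lra Factorial.
From Coquelicot Require Import Coquelicot.

Open Scope R_scope.

(** Write [w0], [w1] for the two periods, [t = I / w0], and
    [E f = z (1 - z) f'' + (1 - 2 z) f' - (2/9) f], so that [L_PF f = z E f].

    The Wronskian [W = w0' w1 - w0 w1'] satisfies
    [(z (1 - z) (f' g - f g'))' = (E f) g - f (E g)], the Lagrange identity
    for [E].  Hence [z (1 - z) W] is a constant [K], and it is nonzero: on the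
    lens where [w1] is the reflected Gauss series, its value at [1/2] is a
    nonzero multiple of [w0 (1/2) * w0' (1/2)].  The differential equation and
    the value of [K] pass to every branch of [w1] by the identity theorem.
    The series [w0] has no zero in the unit disc because its coefficients are
    positive and decreasing (Enestrom-Kakeya), so [tau] and [t] are
    holomorphic and [tau' = - W / w0^2] does not vanish.

    The GKZ equation says that [L_PF I] is a constant [k].  By the Lagrange
    identity for the pair [I], [w0], the slope [F = dt / dtau] is
    [z (1 - z) (I' w0 - I w0') / (- K)], with derivative [- k w0 / (K z)].
    Both integrals are then one integration by parts: since [dt = F dtau], the
    function [v |-> F(v) (tau(z) - tau(v)) + t(v)] has derivative
    [F'(v) (tau(z) - tau(v))], which is [- k] times the first integrand.  Its
    increment from [z0] to [z] gives the first formula with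
    [c = - k], [b = F(z0)] and [a = t(z0) - F(z0) tau(z0)].  Pulling the same
    primitive back by [alpha] and using [alpha' = 1 / tau'] turns
    [F' dalpha] into [(k / K^2) (1 - alpha) w0^3 dtau], which is the second
    formula with [c = k / K^2].

    The primitive is [path_integral_primitive]; the facts on the periods are
    [omega0_neq_0] and [omega1_properties]; the derivative of the slope is
    [slope_derive]. *)

Local Notation is_cderive f z l := (@is_derive C_AbsRing C_NormedModule f z l).

(** * Complex differentiability and path integrals *)

(** The neighbourhoods of [C] as a product of two lines and those given by the
    modulus are the same filter, but two different terms; this lemma and the
    next one translate between them. *)
Lemma locally_Cmod (p : C) (P : C -> Prop) :
  @locally C_UniformSpace p P <->
  exists d, 0 < d /\ forall x : C, Cmod (x - p)%C < d -> P x.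
Proof.
  split.
  - intros [e He]. exists e. split; [apply cond_pos|].
    intros x Hx. apply He. apply C_NormedModule_mixin_compat1. exact Hx.
  - intros [d [Hd H]].
    assert (Hf : 0 < @norm_factor _ C_NormedModule) by apply norm_factor_gt_0.
    assert (Hd' : 0 < d / @norm_factor _ C_NormedModule)
      by (apply Rdiv_lt_0_compat; assumption).
    exists (mkposreal _ Hd'). intros x Hx. apply H.
    apply (@norm_compat2 _ C_NormedModule) in Hx. simpl in Hx.
    replace d with (@norm_factor _ C_NormedModule * (d / @norm_factor _ C_NormedModule))
      by (field; lra).
    exact Hx.
Qed.

Lemma locally_absring (p : C) (P : C -> Prop) :
  @locally (AbsRing_UniformSpace C_AbsRing) p P <-> @locally C_UniformSpace p P.
Proof.
  rewrite locally_Cmod. split.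
  - intros [e He]. exists e. split; [apply cond_pos|]. intros x Hx. apply He. exact Hx.
  - intros [d [Hd H]]. exists (mkposreal _ Hd). intros x Hx. apply H. exact Hx.
Qed.

(** The two normed-module structures on [C] over itself have the same norm and
    the same operations and differ only in their balls, which do not occur in
    the definition of the derivative.  The product and chain rules are stated
    for one of them and the theorem uses the other. *)
Lemma cderive_absring (f : C -> C) (z l : C) :
  @is_derive C_AbsRing (AbsRing_NormedModule C_AbsRing) f z l <-> is_cderive f z l.
Proof.
  split; intros [_ H]; (split; [apply is_linear_scal_l |]);
    intros x Hx e; exact (H x Hx e).
Qed.

Lemma cderive_plus (f g : C -> C) (z a b : C) :
  is_cderive f z a -> is_cderive g z b -> is_cderive (fun x => f x + g x)%C z (a + b)%C.
Proof. exact (@is_derive_plus C_AbsRing C_NormedModule f g z a b). Qed.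

Lemma cderive_minus (f g : C -> C) (z a b : C) :
  is_cderive f z a -> is_cderive g z b -> is_cderive (fun x => f x - g x)%C z (a - b)%C.
Proof. exact (@is_derive_minus C_AbsRing C_NormedModule f g z a b). Qed.

Lemma cderive_mult (f g : C -> C) (z a b : C) : is_cderive f z a -> is_cderive g z b ->
  is_cderive (fun x => f x * g x)%C z (a * g z + f z * b)%C.
Proof.
  intros Hf Hg. apply cderive_absring.
  apply (@is_derive_mult C_AbsRing f g z a b).
  - now apply cderive_absring.
  - now apply cderive_absring.
  - exact Cmult_comm.
Qed.

Lemma cderive_id (z : C) : is_cderive (fun x => x) z (RtoC 1).
Proof. apply cderive_absring. exact (@is_derive_id C_AbsRing z). Qed.

Lemma cderive_const (c z : C) : is_cderive (fun _ => c) z (RtoC 0).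
Proof. exact (@is_derive_const C_AbsRing C_NormedModule c z). Qed.

Lemma cderive_comp (f g : C -> C) (z a b : C) :
  is_cderive f (g z) a -> is_cderive g z b -> is_cderive (fun x => f (g x)) z (b * a)%C.
Proof.
  intros Hf Hg. apply cderive_absring in Hg.
  exact (@is_derive_comp C_AbsRing C_NormedModule f g z a b Hf Hg).
Qed.

Lemma cderive_ext (f g : C -> C) (z l : C) : @locally C_UniformSpace z (fun x => f x = g x) ->
  is_cderive f z l -> is_cderive g z l.
Proof.
  intros H. apply (@is_derive_ext_loc C_AbsRing C_NormedModule).
  now apply locally_absring.
Qed.

Lemma cderive_eps (f : C -> C) (z l : C) :
  (forall e, 0 < e -> exists d, 0 < d /\ forall x : C, Cmod (x - z)%C < d ->
     Cmod (f x - f z - (x - z) * l)%C <= e * Cmod (x - z)%C) ->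
  is_cderive f z l.
Proof.
  intros H. split; [apply is_linear_scal_l |].
  intros x Hx e.
  assert (Hx' : z = x).
  { apply (@is_filter_lim_locally_unique C_AbsRing (AbsRing_NormedModule C_AbsRing)). exact Hx. }
  subst x.
  destruct (H e (cond_pos e)) as [d [Hd Hd2]].
  exists (mkposreal _ Hd). intros y Hy. exact (Hd2 y Hy).
Qed.

(** From [1/x - 1/z + (x - z)/z^2 = (x - z)^2 / (x z^2)]. *)
Lemma cderive_inv (z : C) : z <> RtoC 0 -> is_cderive Cinv z (- (/ (z * z)))%C.
Proof.
  intros Hz. apply cderive_eps. intros e He.
  assert (Hm : 0 < Cmod z) by now apply Cmod_gt_0.
  set (m := Cmod z) in *.
  assert (Hm3 : 0 < m * m * m) by (repeat apply Rmult_lt_0_compat; assumption).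
  (* [m / 2] keeps [x] away from [0]; the other bound makes the remainder at
     most [e * Cmod (x - z)]. *)
  exists (Rmin (m / 2) (e * (m * m * m) / 2)). split.
  { apply Rmin_glb_lt; [lra|]. apply Rdiv_lt_0_compat; [|lra].
    now apply Rmult_lt_0_compat. }
  intros x Hx.
  set (h := (x - z)%C) in *.
  assert (Hh1 : Cmod h < m / 2) by (eapply Rlt_le_trans; [exact Hx | apply Rmin_l]).
  assert (Hh2 : Cmod h < e * (m * m * m) / 2) by (eapply Rlt_le_trans; [exact Hx | apply Rmin_r]).
  assert (Hxm : m / 2 < Cmod x).
  { assert (Ht := Cmod_triangle x (- h)%C).
    replace (x + - h)%C with z in Ht by (unfold h; ring).
    rewrite Cmod_opp in Ht. fold m in Ht. lra. }
  assert (Hx0 : x <> RtoC 0) by (apply Cmod_gt_0; lra).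
  replace (/ x - / z - h * - / (z * z))%C with (h * h / (x * (z * z)))%C
    by (unfold h; field; split; assumption).
  rewrite Cmod_div, !Cmod_mult by (repeat apply Cmult_neq_0; assumption).
  fold m.
  assert (Hq : Cmod h / (Cmod x * (m * m)) <= e).
  { apply Rmult_le_reg_r with (Cmod x * (m * m)).
    - apply Rmult_lt_0_compat; [lra | now apply Rmult_lt_0_compat].
    - unfold Rdiv. rewrite Rmult_assoc, Rinv_l.
      + rewrite Rmult_1_r. apply Rle_trans with (e * (m / 2 * (m * m))); [nra|].
        apply Rmult_le_compat_l; [lra|]. apply Rmult_le_compat_r; [nra | lra].
      + apply Rgt_not_eq. apply Rmult_lt_0_compat; [lra | now apply Rmult_lt_0_compat]. }
  replace (Cmod h * Cmod h / (Cmod x * (m * m))) with (Cmod h / (Cmod x * (m * m)) * Cmod h)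
    by (unfold Rdiv; ring).
  apply Rmult_le_compat_r; [apply Cmod_ge_0 | exact Hq].
Qed.

Lemma cderive_div (f g : C -> C) (z a b : C) :
  g z <> RtoC 0 -> is_cderive f z a -> is_cderive g z b ->
  is_cderive (fun x => f x / g x)%C z ((a * g z - f z * b) / (g z * g z))%C.
Proof.
  intros Hz Hf Hg.
  replace ((a * g z - f z * b) / (g z * g z))%C
    with (a * / g z + f z * (b * - (/ (g z * g z))))%C by (field; exact Hz).
  apply (cderive_mult f (fun x => / g x)%C z a _ Hf).
  apply cderive_comp; [now apply cderive_inv | exact Hg].
Qed.

Lemma ex_cderive (f : C -> C) (z : C) :
  @ex_derive C_AbsRing C_NormedModule f z -> is_cderive f z (C_derive f z).
Proof. intros H. apply C_derive_correct; [exact z | exact H]. Qed.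

Lemma cderive_continuous (f : C -> C) (z l : C) :
  is_cderive f z l -> @continuous C_UniformSpace C_UniformSpace f z.
Proof.
  intros H. assert (Hc : @continuous (AbsRing_UniformSpace C_AbsRing) C_UniformSpace f z).
  { apply (@ex_derive_continuous C_AbsRing C_NormedModule). now exists l. }
  intros P HP. apply locally_absring. exact (Hc P HP).
Qed.

Lemma continuous_Cmult (f g : R -> C) t :
  @continuous R_UniformSpace C_UniformSpace f t ->
  @continuous R_UniformSpace C_UniformSpace g t ->
  @continuous R_UniformSpace C_UniformSpace (fun x => f x * g x)%C t.
Proof.
  intros Hf Hg.
  apply (@continuous_scal R_UniformSpace C_AbsRing C_NormedModule f g t); [|exact Hg].
  intros P HP. apply Hf. now apply locally_absring.
Qed.

(** A complex derivative is in particular a real differential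
    [y |-> l * y] of the plane, to which the chain rule over [R] applies. *)
Lemma cderive_along (f : C -> C) (g : R -> C) (t : R) (l dg : C) : is_cderive f (g t) l ->
  @is_derive R_AbsRing C_R_NormedModule g t dg ->
  @is_derive R_AbsRing C_R_NormedModule (fun x => f (g x)) t (l * dg)%C.
Proof.
  intros [_ Hf] Hg.
  assert (Hd : @filterdiff R_AbsRing C_R_NormedModule C_R_NormedModule f
                 (@locally C_UniformSpace (g t)) (fun y => l * y)%C).
  { split.
    - split.
      + intros x y. apply Cmult_plus_distr_l.
      + intros k x. destruct l as [l1 l2], x as [x1 x2].
        apply injective_projections; simpl; unfold scal; simpl; unfold mult; simpl; ring.
      + exists (Cmod l + 1). split; [generalize (Cmod_ge_0 l); lra|].
        intros x. rewrite <- !Cmod_norm.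
        rewrite Cmod_mult. generalize (Cmod_ge_0 x); nra.
    - intros x Hx e.
      apply (@is_filter_lim_locally_unique R_AbsRing C_R_NormedModule) in Hx.
      subst x.
      assert (H := Hf (g t) (fun P HP => HP) e).
      apply locally_absring in H.
      revert H. apply filter_imp. intros y Hy.
      rewrite <- !Cmod_norm, (Cmult_comm l). exact Hy. }
  refine (filterdiff_ext_lin _ (fun y : R => l * (@scal R_AbsRing C_R_NormedModule y dg))%C _ _ _).
  - apply (@filterdiff_comp' R_AbsRing R_NormedModule C_R_NormedModule C_R_NormedModule g f t
      (fun y : R => @scal R_AbsRing C_R_NormedModule y dg) (fun y => l * y)%C Hg Hd).
  - intros y. destruct l as [l1 l2], dg as [x1 x2].
    apply injective_projections; simpl; unfold scal; simpl; unfold mult; simpl; ring.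
Qed.

(** The integral is linear over [R] only by construction; over [C] this is
    seen on real and imaginary parts. *)
Lemma is_RInt_Cmult (c : C) (f : R -> C) a b v :
  @is_RInt C_R_NormedModule f a b v ->
  @is_RInt C_R_NormedModule (fun t => c * f t)%C a b (c * v)%C.
Proof.
  intros H.
  assert (H1 := is_RInt_fct_extend_fst (U:=R_NormedModule) (V:=R_NormedModule) _ _ _ _ H).
  assert (H2 := is_RInt_fct_extend_snd (U:=R_NormedModule) (V:=R_NormedModule) _ _ _ _ H).
  destruct c as [c1 c2].
  apply (is_RInt_fct_extend_pair (U:=R_NormedModule) (V:=R_NormedModule)).
  - exact (is_RInt_minus (V:=R_NormedModule) _ _ _ _ _ _
      (is_RInt_scal (V:=R_NormedModule) _ _ _ c1 _ H1) (is_RInt_scal (V:=R_NormedModule) _ _ _ c2 _ H2)).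
  - exact (is_RInt_plus (V:=R_NormedModule) _ _ _ _ _ _
      (is_RInt_scal (V:=R_NormedModule) _ _ _ c1 _ H2) (is_RInt_scal (V:=R_NormedModule) _ _ _ c2 _ H1)).
Qed.

(** The constant [c] is kept outside of the integrand so that the integral of
    [k] exists even when [c = 0], a case in which [G] says nothing about it. *)
Lemma path_integral_primitive (D : C -> Prop) (G k : C -> C) (c z0 z : C) (g dg : R -> C) :
  C1_path D g dg z0 z ->
  (forall v, D v -> is_cderive G v (c * k v)%C) ->
  (forall v, D v -> @ex_derive C_AbsRing C_NormedModule k v) ->
  exists J, is_path_integral k g dg J /\ (c * J = G z - G z0)%C.
Proof.
  intros [Hg [Hg0 Hg1]] HG Hk.
  assert (Hin : forall x, Rmin 0 1 <= x <= Rmax 0 1 -> 0 <= x <= 1)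
    by (intros x; rewrite Rmin_left, Rmax_right by lra; tauto).
  assert (Hcont : forall t, 0 <= t <= 1 ->
     @continuous R_UniformSpace C_UniformSpace (fun t => k (g t) * dg t)%C t).
  { intros t Ht. destruct (Hg t Ht) as [HD [Hd Hc]].
    apply continuous_Cmult; [|exact Hc].
    apply (continuous_comp g k).
    - apply (@ex_derive_continuous R_AbsRing C_R_NormedModule). now exists (dg t).
    - destruct (Hk _ HD) as [l Hl]. exact (cderive_continuous _ _ _ Hl). }
  destruct (@ex_RInt_continuous C_R_CompleteNormedModule (fun t => k (g t) * dg t)%C 0 1) as [J HJ].
  { intros t Ht. apply Hcont. now apply Hin. }
  exists J. split; [exact HJ|].
  assert (H1 := is_RInt_Cmult c _ _ _ _ HJ).
  assert (H2 : @is_RInt C_R_NormedModule (fun t => c * (k (g t) * dg t))%C 0 1 (G z - G z0)%C).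
  { rewrite <- Hg0, <- Hg1.
    apply (@is_RInt_derive C_R_CompleteNormedModule (fun t => G (g t)) (fun t => c * (k (g t) * dg t))%C).
    - intros t Ht. destruct (Hg t (Hin t Ht)) as [HD [Hd Hc]].
      rewrite Cmult_assoc.
      apply cderive_along; [now apply HG | exact Hd].
    - intros t Ht. apply continuous_Cmult.
      + apply continuous_const.
      + apply Hcont. now apply Hin. }
  rewrite <- (@is_RInt_unique C_R_CompleteNormedModule _ _ _ _ H1).
  exact (@is_RInt_unique C_R_CompleteNormedModule _ _ _ _ H2).
Qed.

(** * Complex power series *)

Definition Cseries (u : nat -> C) (l : C) : Prop := @is_series C_AbsRing C_NormedModule u l.

Lemma Cseries_pair u l : Cseries u l ->
  is_series (fun n => Re (u n)) (Re l) /\ is_series (fun n => Im (u n)) (Im l).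
Proof.
  intros H. split.
  - apply filterlim_ext with (fun n => fst (@sum_n C_AbsRing u n)).
    + intros n. induction n.
      * now rewrite !sum_O.
      * rewrite !sum_Sn, <- IHn. reflexivity.
    + apply (filterlim_comp _ _ _ (@sum_n C_AbsRing u) fst) with (1 := H). apply continuous_fst.
  - apply filterlim_ext with (fun n => snd (@sum_n C_AbsRing u n)).
    + intros n. induction n.
      * now rewrite !sum_O.
      * rewrite !sum_Sn, <- IHn. reflexivity.
    + apply (filterlim_comp _ _ _ (@sum_n C_AbsRing u) snd) with (1 := H). apply continuous_snd.
Qed.

(** Each term is a difference of two partial sums, which are bounded. *)
Lemma Cseries_bounded u l : Cseries u l -> exists M, forall n, Cmod (u n) <= M.
Proof.
  intros H.
  destruct (@filterlim_bounded C_AbsRing C_NormedModule (@sum_n C_AbsRing u)) as [M HM].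
  { now exists l. }
  exists (M + M). intros [|n].
  - generalize (HM O). rewrite sum_O. intros H0.
    change (Cmod (u O) <= M) in H0. generalize (Cmod_ge_0 (u O)). lra.
  - assert (H1 := HM n). assert (H2 := HM (S n)). rewrite sum_Sn in H2.
    change (Cmod (@sum_n C_AbsRing u n + u (S n))%C <= M) in H2.
    change (Cmod (@sum_n C_AbsRing u n) <= M) in H1.
    set (s := @sum_n C_AbsRing u n : C) in *.
    replace (u (S n)) with ((s + u (S n)) + - s)%C by ring.
    eapply Rle_trans; [apply Cmod_triangle|]. rewrite Cmod_opp. lra.
Qed.

Lemma Cseries_norm_le u (l : C) (b : nat -> R) (B : R) : Cseries u l ->
  (forall N, sum_n (fun n => Cmod (u n)) N <= b N) -> is_lim_seq b B -> Cmod l <= B.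
Proof.
  intros Hu Hb HB.
  apply (is_lim_seq_le (fun N => Cmod (@sum_n C_AbsRing u N)) b (Cmod l) B).
  - intros N. eapply Rle_trans; [apply (@norm_sum_n_m C_AbsRing C_NormedModule) | apply Hb].
  - eapply filterlim_comp; [exact Hu | apply (@filterlim_norm C_AbsRing C_NormedModule)].
  - exact HB.
Qed.

Lemma Cseries_tail u l : Cseries u l -> Cseries (fun n => u (S n)) (l - u O)%C.
Proof.
  intros H. apply (@is_series_incr_1 C_AbsRing C_NormedModule).
  replace (@plus C_NormedModule (l - u O)%C (u O)) with l; [exact H|].
  change (l = l - u O + u O)%C. ring.
Qed.

Lemma Cseries_plus u v a b :
  Cseries u a -> Cseries v b -> Cseries (fun n => u n + v n)%C (a + b)%C.
Proof. exact (@is_series_plus C_AbsRing C_NormedModule u v a b). Qed.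

Lemma Cseries_minus u v a b :
  Cseries u a -> Cseries v b -> Cseries (fun n => u n - v n)%C (a - b)%C.
Proof. exact (@is_series_minus C_AbsRing C_NormedModule u v a b). Qed.

Lemma Cseries_scal c u a : Cseries u a -> Cseries (fun n => c * u n)%C (c * a)%C.
Proof. exact (@is_series_scal C_AbsRing C_NormedModule c u a). Qed.

Lemma Cpseries_iff a z l :
  @is_pseries C_AbsRing C_NormedModule a z l <-> Cseries (fun n => a n * z ^ n)%C l.
Proof.
  assert (E : forall n, @scal C_AbsRing C_NormedModule (@pow_n C_AbsRing z n) (a n) = (a n * z ^ n)%C).
  { intros n. exact (Cmult_comm _ _). }
  split; apply is_series_ext; intros n; [apply E | symmetry; apply E].
Qed.

(** The sum is taken on real and imaginary parts, so that [omega0] is an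
    instance by conversion. *)
Definition Cpower_sum (a : nat -> C) (z : C) : C :=
  (Series (fun n => Re (a n * z ^ n)%C), Series (fun n => Im (a n * z ^ n)%C)).

(** The radius of the real series of moduli, whose theory then supplies
    absolute convergence and the radius of the differentiated series. *)
Definition Cradius (a : nat -> C) : Rbar := CV_radius (fun n => Cmod (a n)).

Lemma Cpower_sum_unique a z l : Cseries (fun n => a n * z ^ n)%C l -> Cpower_sum a z = l.
Proof.
  intros H. apply Cseries_pair in H. destruct H as [H1 H2].
  apply injective_projections; apply is_series_unique; assumption.
Qed.

Lemma Cpower_sum_correct a z :
  Rbar_lt (Cmod z) (Cradius a) -> Cseries (fun n => a n * z ^ n)%C (Cpower_sum a z).
Proof.
  intros H.
  destruct (@ex_series_le C_AbsRing C_CompleteNormedModule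
    (fun n => a n * z ^ n)%C (fun n => Rabs (Cmod (a n) * Cmod z ^ n))) as [l Hl].
  - intros n. change (Cmod (a n * z ^ n)%C <= Rabs (Cmod (a n) * Cmod z ^ n)).
    rewrite Cmod_mult, Cmod_pow. apply Rle_abs.
  - apply CV_disk_inside. rewrite Rabs_pos_eq by apply Cmod_ge_0. exact H.
  - rewrite (Cpower_sum_unique _ _ _ Hl). exact Hl.
Qed.

(** Convergence at a point strictly between the radius and [r] would bound the
    terms there, against the definition of the radius. *)
Lemma Cradius_ge a r :
  (forall h : C, Cmod h < r -> exists l, Cseries (fun n => a n * h ^ n)%C l) ->
  Rbar_le r (Cradius a).
Proof.
  intros H. apply Rbar_not_lt_le. intros Hlt.
  destruct (CV_radius_bounded (fun n => Cmod (a n))) as [Hub _]. fold (Cradius a) in Hub.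
  assert (H0 := CV_radius_ge_0 (fun n => Cmod (a n))). fold (Cradius a) in H0.
  destruct (Cradius a) as [m| |]; simpl in Hlt, H0; try contradiction.
  set (rho := (m + r) / 2).
  assert (Hr : Cmod (RtoC rho) = rho).
  { rewrite Cmod_R. apply Rabs_pos_eq. unfold rho. lra. }
  destruct (H (RtoC rho)) as [l Hl]; [rewrite Hr; unfold rho; lra|].
  destruct (Cseries_bounded _ _ Hl) as [M HM].
  assert (Hle : Rbar_le rho m).
  { apply Hub. exists M. intros n. generalize (HM n).
    rewrite Cmod_mult, Cmod_pow, Hr. intros Hn. rewrite Rabs_pos_eq; [exact Hn|].
    apply Rmult_le_pos; [apply Cmod_ge_0 | apply pow_le; unfold rho; lra]. }
  simpl in Hle. unfold rho in Hle. lra.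
Qed.

Definition PS_Cderive (a : nat -> C) (n : nat) : C := (RtoC (INR (S n)) * a (S n))%C.

Lemma Cmod_PS_Cderive a n : Cmod (PS_Cderive a n) = PS_derive (fun n => Cmod (a n)) n.
Proof.
  unfold PS_Cderive, PS_derive. rewrite Cmod_mult, Cmod_R, Rabs_pos_eq by apply pos_INR. reflexivity.
Qed.

Lemma Cradius_PS_Cderive a : Cradius (PS_Cderive a) = Cradius a.
Proof.
  unfold Cradius. rewrite <- (CV_radius_derive (fun n => Cmod (a n))).
  apply CV_radius_ext. apply Cmod_PS_Cderive.
Qed.

(** The remainder [E n] of the Taylor formula of order one satisfies
    [E (n+1) = y * E n + n * x^(n-1) * (y - x)^2], whence the bound by
    induction. *)
Lemma pow_second_order (x y : C) R n : Cmod x <= R -> Cmod y <= R ->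
  Cmod (y ^ (S (S n)) - x ^ (S (S n)) - RtoC (INR (S (S n))) * x ^ (S n) * (y - x))%C
  <= INR (S (S n)) * INR (S n) * R ^ n * (Cmod (y - x)%C * Cmod (y - x)%C).
Proof.
  intros Hx Hy. set (k := Cmod (y - x)%C).
  assert (Hk : 0 <= k) by apply Cmod_ge_0.
  assert (HR : 0 <= R) by (apply Rle_trans with (2 := Hx); apply Cmod_ge_0).
  induction n as [|n IH].
  - replace (y ^ 2 - x ^ 2 - RtoC (INR 2) * x ^ 1 * (y - x))%C with ((y - x) * (y - x))%C.
    + rewrite Cmod_mult. fold k. simpl. nra.
    + simpl. rewrite RtoC_plus. ring.
  - set (E := (y ^ (S (S n)) - x ^ (S (S n)) - RtoC (INR (S (S n))) * x ^ (S n) * (y - x))%C) in *.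
    replace (y ^ (S (S (S n))) - x ^ (S (S (S n))) - RtoC (INR (S (S (S n)))) * x ^ (S (S n)) * (y - x))%C
      with (y * E + RtoC (INR (S (S n))) * x ^ (S n) * ((y - x) * (y - x)))%C.
    + eapply Rle_trans; [apply Cmod_triangle|].
      rewrite !Cmod_mult, Cmod_pow, Cmod_R, (Rabs_pos_eq (INR _)) by apply pos_INR.
      fold k.
      assert (Hp : Cmod x ^ S n <= R ^ S n) by (apply pow_incr; split; [apply Cmod_ge_0 | exact Hx]).
      assert (Hp0 : 0 <= R ^ n) by now apply pow_le.
      assert (Hi : 0 <= INR n) by apply pos_INR.
      assert (Hkk : 0 <= k * k) by nra.
      assert (H1 : Cmod y * Cmod E <= R * (INR (S (S n)) * INR (S n) * R ^ n * (k * k))).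
      { apply Rmult_le_compat; try apply Cmod_ge_0; assumption. }
      assert (H2 : INR (S (S n)) * Cmod x ^ S n * (k * k) <= INR (S (S n)) * R ^ S n * (k * k)).
      { apply Rmult_le_compat_r; [exact Hkk|]. apply Rmult_le_compat_l; [apply pos_INR | exact Hp]. }
      eapply Rle_trans; [apply Rplus_le_compat; [exact H1 | exact H2]|].
      simpl (R ^ S n). rewrite !S_INR.
      assert (Hq : 0 <= R * R ^ n * (k * k)) by (repeat apply Rmult_le_pos; assumption).
      nra.
    + unfold E. rewrite (S_INR (S (S n))), RtoC_plus. simpl (_ ^ S (S (S n)))%C.
      simpl (_ ^ S (S n))%C. simpl (_ ^ S n)%C. ring.
Qed.

Lemma Rbar_between (x : R) (m : Rbar) : Rbar_lt x m -> exists y : R, x < y /\ Rbar_lt y m.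
Proof.
  destruct m as [m| |]; simpl; intros H; try contradiction.
  - exists ((x + m) / 2). lra.
  - exists (x + 1). split; [lra | exact I].
Qed.

(** Termwise, the remainder of order one is bounded by [|y - x|^2] times the
    terms of the twice differentiated series of moduli at a radius [R] strictly
    between [|x|] and the radius of convergence. *)
Lemma Cpower_sum_cderive a x :
  Rbar_lt (Cmod x) (Cradius a) -> is_cderive (Cpower_sum a) x (Cpower_sum (PS_Cderive a) x).
Proof.
  intros Hx. destruct (Rbar_between _ _ Hx) as [R [HxR HR]].
  assert (HR0 : 0 < R) by (apply Rle_lt_trans with (2 := HxR); apply Cmod_ge_0).
  set (A2 := PS_derive (PS_derive (fun n => Cmod (a n)))).
  assert (HS : ex_series (fun n => A2 n * R ^ n)).
  { apply ex_series_Rabs. apply CV_disk_inside. unfold A2.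
    rewrite !CV_radius_derive, Rabs_pos_eq by lra. exact HR. }
  destruct HS as [S HS].
  assert (Hbound : forall y : C, Cmod y <= R ->
    Cmod (Cpower_sum a y - Cpower_sum a x - (y - x) * Cpower_sum (PS_Cderive a) x)%C <= S * (Cmod (y - x)%C * Cmod (y - x)%C)).
  { intros y Hy.
    assert (Hy' : Rbar_lt (Cmod y) (Cradius a)) by (eapply Rbar_le_lt_trans; [|exact HR]; exact Hy).
    assert (Sy := Cseries_tail _ _ (Cseries_tail _ _ (Cpower_sum_correct a y Hy'))).
    assert (Sx := Cseries_tail _ _ (Cseries_tail _ _ (Cpower_sum_correct a x Hx))).
    assert (Hx' := Hx). rewrite <- Cradius_PS_Cderive in Hx'.
    assert (Sd := Cseries_tail _ _ (Cpower_sum_correct _ x Hx')).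
    assert (Sall := Cseries_minus _ _ _ _ (Cseries_minus _ _ _ _ Sy Sx) (Cseries_scal (y - x)%C _ _ Sd)).
    (* The terms of degree 0 and 1 of the remainder cancel. *)
    match type of Sall with Cseries _ ?l =>
      replace (Cpower_sum a y - Cpower_sum a x - (y - x) * Cpower_sum (PS_Cderive a) x)%C with l end.
    - apply Cseries_norm_le with (1 := Sall)
        (b := sum_n (fun n => A2 n * R ^ n * (Cmod (y - x)%C * Cmod (y - x)%C))).
      + intros N. apply sum_n_m_le. intros n.
        match goal with |- Cmod ?t <= _ =>
          replace t with (a (Datatypes.S (Datatypes.S n)) * (y ^ (Datatypes.S (Datatypes.S n)) - x ^ (Datatypes.S (Datatypes.S n)) - RtoC (INR (Datatypes.S (Datatypes.S n))) * x ^ (Datatypes.S n) * (y - x)))%C end.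
        * rewrite Cmod_mult.
          eapply Rle_trans; [apply Rmult_le_compat_l; [apply Cmod_ge_0 | apply pow_second_order with (R := R); [lra | exact Hy]]|].
          unfold A2, PS_derive. apply Req_le. ring.
        * unfold PS_Cderive. simpl (_ ^ _)%C. ring.
      + exact (is_series_scal_r (Cmod (y - x)%C * Cmod (y - x)%C) _ _ HS).
    - unfold PS_Cderive. simpl (_ ^ _)%C. simpl (INR 1). ring. }
  apply cderive_eps. intros e He.
  assert (HS0 := Rabs_pos S).
  exists (Rmin (R - Cmod x) (e / (Rabs S + 1))). split.
  { apply Rmin_glb_lt; [lra|]. apply Rdiv_lt_0_compat; lra. }
  intros y Hy.
  assert (H1 : Cmod (y - x)%C < R - Cmod x) by (eapply Rlt_le_trans; [exact Hy | apply Rmin_l]).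
  assert (H2 : Cmod (y - x)%C < e / (Rabs S + 1)) by (eapply Rlt_le_trans; [exact Hy | apply Rmin_r]).
  eapply Rle_trans; [apply Hbound|].
  - replace y with ((y - x) + x)%C by ring. eapply Rle_trans; [apply Cmod_triangle | lra].
  - assert (Hd := Cmod_ge_0 (y - x)%C). rewrite <- Rmult_assoc.
    apply Rmult_le_compat_r; [exact Hd|].
    apply Rle_trans with (Rabs S * (e / (Rabs S + 1))); [generalize (Rle_abs S); nra|].
    apply Rmult_le_reg_r with (Rabs S + 1); [lra|]. field_simplify; nra.
Qed.

(** * Analytic functions and analytic continuation *)

Definition expansion (f : C -> C) (z : C) (a : nat -> C) (r : R) : Prop :=
  0 < r /\ forall h : C, Cmod h < r -> Cseries (fun n => a n * h ^ n)%C (f (z + h)%C).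

Lemma analytic_expansion U f z : analytic_on U f -> U z -> exists a r, expansion f z a r.
Proof.
  intros Hf Hz. destruct (Hf z Hz) as [a [r [Hr H]]]. exists a, r. split; [exact Hr|].
  intros h Hh. apply Cpseries_iff. now apply H.
Qed.

Lemma expansion_analytic (U : C -> Prop) f :
  (forall z, U z -> exists a r, expansion f z a r) -> analytic_on U f.
Proof.
  intros H z Hz. destruct (H z Hz) as [a [r [Hr Ha]]]. exists a, r. split; [exact Hr|].
  intros h Hh. apply Cpseries_iff. now apply Ha.
Qed.

Lemma expansion_Cradius f z a r :
  expansion f z a r -> forall h : C, Cmod h < r -> Rbar_lt (Cmod h) (Cradius a).
Proof.
  intros [_ H] h Hh. apply Rbar_lt_le_trans with r; [exact Hh|].
  apply Cradius_ge. intros k Hk. eexists. now apply H.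
Qed.

Lemma expansion_cderive f z a r h : expansion f z a r -> Cmod h < r ->
  is_cderive f (z + h)%C (Cpower_sum (PS_Cderive a) h).
Proof.
  intros H Hh.
  assert (Hs : is_cderive (fun x => Cpower_sum a (x - z)%C) (z + h)%C (1 * Cpower_sum (PS_Cderive a) h)%C).
  { apply (cderive_comp (Cpower_sum a) (fun x => x - z)%C).
    - replace (z + h - z)%C with h by ring. apply Cpower_sum_cderive. exact (expansion_Cradius _ _ _ _ H h Hh).
    - replace (RtoC 1) with (1 - 0)%C by ring. apply cderive_minus; [apply cderive_id | apply cderive_const]. }
  rewrite Cmult_1_l in Hs. revert Hs. apply cderive_ext.
  apply locally_Cmod. exists (r - Cmod h). split; [lra|].
  intros x Hx.
  assert (Hxz : Cmod (x - z)%C < r).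
  { replace (x - z)%C with ((x - (z + h)) + h)%C by ring.
    eapply Rle_lt_trans; [apply Cmod_triangle | lra]. }
  destruct H as [_ H]. apply Cpower_sum_unique.
  generalize (H _ Hxz). now replace (z + (x - z))%C with x by ring.
Qed.

Lemma expansion_derive f z a r :
  expansion f z a r -> expansion (C_derive f) z (PS_Cderive a) r.
Proof.
  intros H. split; [apply H|]. intros h Hh.
  rewrite (is_C_derive_unique _ _ _ (expansion_cderive _ _ _ _ _ H Hh)).
  apply Cpower_sum_correct. rewrite Cradius_PS_Cderive. exact (expansion_Cradius _ _ _ _ H h Hh).
Qed.

Lemma expansion_shrink f z a r s : 0 < s <= r -> expansion f z a r -> expansion f z a s.
Proof. intros Hs [_ H]. split; [lra|]. intros h Hh. apply H. lra. Qed.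

Lemma expansion_plus f g z a b r : expansion f z a r -> expansion g z b r ->
  expansion (fun x => f x + g x)%C z (fun n => a n + b n)%C r.
Proof.
  intros [Hr Ha] [_ Hb]. split; [exact Hr|]. intros h Hh.
  eapply (@is_series_ext C_AbsRing C_NormedModule); [|exact (Cseries_plus _ _ _ _ (Ha h Hh) (Hb h Hh))].
  intros n. change (a n * h ^ n + b n * h ^ n = (a n + b n) * h ^ n)%C. ring.
Qed.

Lemma expansion_scal c f z a r : expansion f z a r ->
  expansion (fun x => c * f x)%C z (fun n => c * a n)%C r.
Proof.
  intros [Hr Ha]. split; [exact Hr|]. intros h Hh.
  eapply (@is_series_ext C_AbsRing C_NormedModule); [|exact (Cseries_scal c _ _ (Ha h Hh))].
  intros n. apply Cmult_assoc.
Qed.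

Definition PS_Cshift (a : nat -> C) (n : nat) : C := match n with O => RtoC 0 | S m => a m end.

Lemma Cseries_PS_Cshift a h l :
  Cseries (fun n => a n * h ^ n)%C l -> Cseries (fun n => PS_Cshift a n * h ^ n)%C (h * l)%C.
Proof.
  intros H. apply Cpseries_iff. apply Cpseries_iff in H.
  apply (@is_pseries_ext C_AbsRing C_NormedModule (PS_incr_1 a)); [now intros [|n]|].
  exact (@is_pseries_incr_1 C_AbsRing C_NormedModule a h l H).
Qed.

Lemma expansion_mult_id f z a r : expansion f z a r ->
  expansion (fun x => x * f x)%C z (fun n => z * a n + PS_Cshift a n)%C r.
Proof.
  intros [Hr Ha]. split; [exact Hr|]. intros h Hh.
  replace ((z + h) * f (z + h))%C with (z * f (z + h) + h * f (z + h))%C by ring.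
  eapply (@is_series_ext C_AbsRing C_NormedModule);
    [|exact (Cseries_plus _ _ _ _ (Cseries_scal z _ _ (Ha h Hh)) (Cseries_PS_Cshift _ _ _ (Ha h Hh)))].
  intros n. change (z * (a n * h ^ n) + PS_Cshift a n * h ^ n = (z * a n + PS_Cshift a n) * h ^ n)%C. ring.
Qed.

Lemma analytic_cderive U f z : analytic_on U f -> U z -> is_cderive f z (C_derive f z).
Proof.
  intros Hf Hz. destruct (analytic_expansion _ _ _ Hf Hz) as [a [r H]].
  apply ex_cderive. exists (Cpower_sum (PS_Cderive a) 0).
  replace z with (z + 0)%C by ring. apply (expansion_cderive _ _ _ _ _ H). rewrite Cmod_0. apply H.
Qed.

Lemma analytic_derive U f : analytic_on U f -> analytic_on U (C_derive f).
Proof.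
  intros Hf. apply expansion_analytic. intros z Hz.
  destruct (analytic_expansion _ _ _ Hf Hz) as [a [r H]].
  eexists. eexists. exact (expansion_derive _ _ _ _ H).
Qed.

Lemma analytic_plus U f g : analytic_on U f -> analytic_on U g ->
  analytic_on U (fun x => f x + g x)%C.
Proof.
  intros Hf Hg. apply expansion_analytic. intros z Hz.
  destruct (analytic_expansion _ _ _ Hf Hz) as [a [r Ha]].
  destruct (analytic_expansion _ _ _ Hg Hz) as [b [s Hb]].
  assert (Hp : 0 < Rmin r s) by (apply Rmin_glb_lt; [apply Ha | apply Hb]).
  eexists. exists (Rmin r s). apply expansion_plus.
  - apply expansion_shrink with (2 := Ha). split; [exact Hp | apply Rmin_l].
  - apply expansion_shrink with (2 := Hb). split; [exact Hp | apply Rmin_r].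
Qed.

Lemma analytic_scal U c f : analytic_on U f -> analytic_on U (fun x => c * f x)%C.
Proof.
  intros Hf. apply expansion_analytic. intros z Hz.
  destruct (analytic_expansion _ _ _ Hf Hz) as [a [r Ha]].
  eexists. exists r. exact (expansion_scal c _ _ _ _ Ha).
Qed.

Lemma analytic_mult_id U f : analytic_on U f -> analytic_on U (fun x => x * f x)%C.
Proof.
  intros Hf. apply expansion_analytic. intros z Hz.
  destruct (analytic_expansion _ _ _ Hf Hz) as [a [r Ha]].
  eexists. exists r. exact (expansion_mult_id _ _ _ _ Ha).
Qed.

Lemma Cseries_0_at_0 a l : Cseries (fun n => a n * 0 ^ n)%C l -> l = a O.
Proof.
  intros H. rewrite <- (Cpower_sum_unique _ _ _ H). apply Cpower_sum_unique.
  apply Cpseries_iff. exact (@is_pseries_0 C_AbsRing C_NormedModule a).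
Qed.

(** The constant coefficient is the value at [z], a limit of zeros by
    continuity. *)
Lemma expansion_zero_coef a : forall f z r, expansion f z a r ->
  (forall e, 0 < e -> exists h : C, h <> RtoC 0 /\ Cmod h < e /\ f (z + h)%C = RtoC 0) ->
  a O = RtoC 0.
Proof.
  intros f z r H Hacc.
  assert (H0 : f z = a O).
  { apply Cseries_0_at_0. replace z with (z + 0)%C by ring. apply H. rewrite Cmod_0. apply H. }
  rewrite <- H0.
  assert (Hc : @continuous C_UniformSpace C_UniformSpace f z).
  { apply (cderive_continuous f z (Cpower_sum (PS_Cderive a) 0)).
    replace z with (z + 0)%C by ring. apply (expansion_cderive _ _ _ _ _ H). rewrite Cmod_0. apply H. }
  destruct (Ceq_dec (f z) 0) as [E|E]; [exact E | exfalso].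
  assert (Hn : @locally C_UniformSpace z (fun x => Cmod (f x - f z)%C < Cmod (f z))).
  { apply (Hc (fun y => Cmod (y - f z)%C < Cmod (f z))).
    apply locally_Cmod. exists (Cmod (f z)). split; [now apply Cmod_gt_0 | tauto]. }
  apply locally_Cmod in Hn. destruct Hn as [d [Hd Hn]].
  destruct (Hacc d Hd) as [h [_ [Hh Hfh]]].
  specialize (Hn (z + h)%C). rewrite Hfh in Hn.
  replace (0 - f z)%C with (- f z)%C in Hn by ring. rewrite Cmod_opp in Hn.
  apply (Rlt_irrefl (Cmod (f z))). apply Hn. now replace (z + h - z)%C with h by ring.
Qed.

(** Once the constant coefficient vanishes, [f (z + h) / h] has the shifted
    expansion and the same zeros [h <> 0], so the induction runs through all
    coefficients. *)
Lemma expansion_accumulating_zeros n : forall a f z r, expansion f z a r ->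
  (forall e, 0 < e -> exists h : C, h <> RtoC 0 /\ Cmod h < e /\ f (z + h)%C = RtoC 0) ->
  a n = RtoC 0.
Proof.
  induction n as [|n IH]; intros a f z r H Hacc.
  - exact (expansion_zero_coef a f z r H Hacc).
  - assert (Ha0 := expansion_zero_coef a f z r H Hacc).
    assert (HS : forall h : C, h <> RtoC 0 -> Cmod h < r ->
      Cseries (fun n => a (S n) * h ^ n)%C (f (z + h) / h)%C).
    { intros h Hh Hr. destruct H as [_ H].
      assert (Hs := Cseries_scal (/ h)%C _ _ (Cseries_tail _ _ (H h Hr))).
      cbv beta in Hs. rewrite Ha0 in Hs.
      replace (f (z + h) / h)%C with (/ h * (f (z + h) - 0 * h ^ 0))%C by (field; exact Hh).
      revert Hs. apply is_series_ext. intros m.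
      change (/ h * (a (S m) * (h * h ^ m)) = a (S m) * h ^ m)%C. field. exact Hh. }
    apply (IH (fun n => a (S n)) (fun x => Cpower_sum (fun n => a (S n)) (x - z)%C) z r).
    + split; [apply H|]. intros h Hr. replace (z + h - z)%C with h by ring.
      destruct (Ceq_dec h 0) as [E|E].
      * subst h. replace (Cpower_sum (fun n => a (S n)) 0) with (a 1%nat).
        -- apply Cpseries_iff. exact (@is_pseries_0 C_AbsRing C_NormedModule (fun n => a (S n))).
        -- symmetry. apply Cpower_sum_unique. apply Cpseries_iff.
           exact (@is_pseries_0 C_AbsRing C_NormedModule (fun n => a (S n))).
      * assert (Hs := HS h E Hr). rewrite (Cpower_sum_unique _ _ _ Hs). exact Hs.
    + intros e He. destruct (Hacc (Rmin e r)) as [h [Hh0 [Hh Hf]]].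
      { apply Rmin_glb_lt; [exact He | apply H]. }
      assert (H1 : Cmod h < e) by (eapply Rlt_le_trans; [exact Hh | apply Rmin_l]).
      assert (H2 : Cmod h < r) by (eapply Rlt_le_trans; [exact Hh | apply Rmin_r]).
      exists h. split; [exact Hh0|]. split; [exact H1|].
      replace (z + h - z)%C with h by ring.
      rewrite (Cpower_sum_unique _ _ _ (HS h Hh0 H2)), Hf. field. exact Hh0.
Qed.

Lemma expansion_vanish f z a r : expansion f z a r ->
  (forall e, 0 < e -> exists h : C, h <> RtoC 0 /\ Cmod h < e /\ f (z + h)%C = RtoC 0) ->
  @locally C_UniformSpace z (fun x => f x = RtoC 0).
Proof.
  intros H Hacc. apply locally_Cmod. exists r. split; [apply H|].
  intros x Hx. replace x with (z + (x - z))%C by ring.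
  rewrite <- (Cpower_sum_unique _ _ _ (proj2 H _ Hx)).
  apply Cpower_sum_unique.
  assert (Hz : Cseries (fun n => RtoC 0 * (a n * (x - z) ^ n))%C (0 * f (z + (x - z)))%C)
    by (apply Cseries_scal; now apply H).
  rewrite Cmult_0_l in Hz. revert Hz. apply is_series_ext. intros n.
  rewrite (expansion_accumulating_zeros n _ _ _ _ H Hacc).
  change (0 * (0 * (x - z) ^ n) = 0 * (x - z) ^ n)%C. ring.
Qed.

(** A property that is open and closed along a path holds at its end if it
    holds at its start: look at the supremum of the times up to which it
    holds. *)
Lemma path_propagation (D P : C -> Prop) (p q : C) :
  path_connected D -> D p -> D q -> P p ->
  (forall z, D z -> P z -> @locally C_UniformSpace z P) ->
  (forall z, D z -> (forall e, 0 < e -> exists x : C, Cmod (x - z)%C < e /\ P x) -> P z) ->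
  P q.
Proof.
  intros HD Hp Hq HP Hopen Hclosed.
  destruct (HD p q Hp Hq) as [g [Hg [HgD [Hg0 Hg1]]]].
  set (E := fun t => 0 <= t <= 1 /\ forall u, 0 <= u <= t -> P (g u)).
  assert (E0 : E 0).
  { split; [lra|]. intros u Hu. replace u with 0 by lra. now rewrite Hg0. }
  destruct (completeness E) as [m [Hub Hlub]].
  { exists 1. intros t [Ht _]. lra. }
  { now exists 0. }
  assert (Hm0 : 0 <= m) by now apply Hub.
  assert (Hm1 : m <= 1) by (apply Hlub; intros t [Ht _]; lra).
  assert (Hbelow : forall u, 0 <= u < m -> P (g u)).
  { intros u Hu. destruct (Classical_Prop.classic (P (g u))) as [H|H]; [exact H | exfalso].
    apply (Rlt_irrefl m). apply Rle_lt_trans with u; [|lra].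
    apply Hlub. intros t [Ht Hall]. apply Rnot_lt_le. intros Hut. apply H. apply Hall. lra. }
  assert (Hnear : forall (Q : C -> Prop), @locally C_UniformSpace (g m) Q ->
    exists d, 0 < d /\ forall t, Rabs (t - m) < d -> Q (g t)).
  { intros Q HQ. destruct (Hg m Q HQ) as [d Hd]. exists d. split; [apply cond_pos|].
    intros t Ht. apply Hd. exact Ht. }
  assert (Pm : P (g m)).
  { destruct (Rle_lt_or_eq_dec 0 m Hm0) as [Hpos|<-]; [|now rewrite Hg0].
    apply Hclosed; [apply HgD; lra|]. intros e He.
    destruct (Hnear (fun x => Cmod (x - g m)%C < e)) as [d [Hd Hd2]].
    { apply locally_Cmod. exists e. tauto. }
    exists (g (Rmax 0 (m - d / 2))).
    assert (Hr := Rmax_l 0 (m - d / 2)). assert (Hr2 := Rmax_r 0 (m - d / 2)).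
    assert (Hr3 : Rmax 0 (m - d / 2) < m) by (apply Rmax_lub_lt; lra).
    split.
    - apply Hd2. rewrite Rabs_left; lra.
    - apply Hbelow. lra. }
  destruct (Hnear P (Hopen _ (HgD m (conj Hm0 Hm1)) Pm)) as [d [Hd Hd2]].
  assert (Hext : forall u, 0 <= u < m + d -> P (g u)).
  { intros u Hu. destruct (Rlt_le_dec u m); [apply Hbelow; lra|].
    apply Hd2. rewrite Rabs_pos_eq; lra. }
  rewrite <- Hg1. apply Hext. split; [lra|].
  apply Rnot_le_lt. intros Hle.
  assert (Hin : E (m + d / 2)).
  { split; [lra|]. intros u Hu. apply Hext. lra. }
  apply Hub in Hin. lra.
Qed.

(** The set of points near which [f] vanishes is open by definition, and closed
    by [expansion_vanish]. *)
Lemma identity_theorem (V : C -> Prop) f p : is_domain V -> analytic_on V f -> V p ->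
  @locally C_UniformSpace p (fun x => f x = RtoC 0) ->
  forall z, V z -> f z = RtoC 0.
Proof.
  intros [_ [_ Hpc]] Hf Hp H0 z Hz.
  apply (@locally_singleton C_UniformSpace z (fun x => f x = RtoC 0)).
  apply (path_propagation V (fun y => @locally C_UniformSpace y (fun x => f x = RtoC 0)) p z
           Hpc Hp Hz H0).
  - intros y _ Hy. now apply locally_locally.
  - intros y Hy Hacc. destruct (analytic_expansion _ _ _ Hf Hy) as [a [r H]].
    apply (expansion_vanish _ _ _ _ H). intros e He.
    destruct (Hacc (e / 2)) as [x [Hx Hx0]]; [lra|].
    apply locally_Cmod in Hx0. destruct Hx0 as [d [Hd Hx0]].
    (* if the zero x is the centre itself, a nearby zero replaces it *)
    destruct (Ceq_dec x y) as [->|Hne].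
    + set (s := Rmin d e / 2). assert (Hs : 0 < Rmin d e) by now apply Rmin_glb_lt.
      assert (Hsd := Rmin_l d e). assert (Hse := Rmin_r d e).
      assert (Hm : Cmod (RtoC s) = s) by (rewrite Cmod_R; apply Rabs_pos_eq; unfold s; lra).
      exists (RtoC s). split.
      * apply Cmod_gt_0. rewrite Hm. unfold s. lra.
      * split; [rewrite Hm; unfold s; lra|]. apply Hx0.
        replace (y + s - y)%C with (RtoC s) by ring. rewrite Hm. unfold s. lra.
    + exists (x - y)%C. split.
      * intros E. apply Hne. replace x with (x - y + y)%C by ring. rewrite E. ring.
      * split; [lra|]. replace (y + (x - y))%C with x by ring. apply Hx0.
        replace (x - x)%C with (RtoC 0) by ring. now rewrite Cmod_0.
Qed.

Lemma is_derive_segment (p q : C) t :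
  @is_derive R_AbsRing C_R_NormedModule (fun t : R => p + RtoC t * (q - p))%C t (q - p)%C.
Proof.
  assert (H := is_derive_plus (K := R_AbsRing) (V := C_R_NormedModule) (fun _ => p) (fun t => scal t (q - p)%C) t _ _
    (is_derive_const (K := R_AbsRing) (V := C_R_NormedModule) p t)
    (is_derive_scal_l (V:=C_R_NormedModule) (fun t => t) t 1 (q - p)%C (is_derive_id (K:=R_AbsRing) t))).
  rewrite plus_zero_l in H.
  change (@scal R_AbsRing C_R_NormedModule 1 (q - p)%C) with (@scal R_AbsRing C_R_NormedModule one (q - p)%C) in H.
  rewrite scal_one in H. revert H.
  apply is_derive_ext. intros u.
  destruct p as [p1 p2], q as [q1 q2].
  apply injective_projections; simpl; unfold scal, plus; simpl; unfold mult; simpl;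
    match goal with |- @eq _ ?a ?b => change (@eq R a b) end; ring.
Qed.

Lemma cderive_0_segment (f : C -> C) (p q : C) :
  (forall t, 0 <= t <= 1 -> is_cderive f (p + RtoC t * (q - p))%C (RtoC 0)) -> f q = f p.
Proof.
  intros H.
  set (D := fun x => is_cderive f x (RtoC 0)).
  destruct (path_integral_primitive D f (fun _ => RtoC 0) 0 p q (fun t : R => p + RtoC t * (q - p))%C (fun _ => (q - p)%C))
    as [J [_ HJ]].
  - split; [|split; ring].
    intros t Ht. split; [now apply H|]. split; [apply is_derive_segment | apply continuous_const].
  - intros v Hv. rewrite Cmult_0_l. exact Hv.
  - intros v _. eexists. apply cderive_const.
  - replace (f q) with (f q - f p + f p)%C by ring. rewrite <- HJ. ring.
Qed.

Lemma cderive_0_constant (D : C -> Prop) (f : C -> C) (p q : C) :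
  is_domain D -> (forall z, D z -> is_cderive f z (RtoC 0)) ->
  D p -> D q -> f q = f p.
Proof.
  intros [_ [Hop Hpc]] Hf Hp Hq.
  assert (Hloc : forall z, D z -> exists d, 0 < d /\ forall x : C, Cmod (x - z)%C < d -> f x = f z).
  { intros z Hz. destruct (proj1 (locally_Cmod z D) (Hop z Hz)) as [d [Hd HD]].
    exists d. split; [exact Hd|]. intros x Hx. apply cderive_0_segment.
    intros t Ht. apply Hf. apply HD.
    replace (z + RtoC t * (x - z) - z)%C with (RtoC t * (x - z))%C by ring.
    rewrite Cmod_mult, Cmod_R, Rabs_pos_eq by lra.
    generalize (Cmod_ge_0 (x - z)%C). nra. }
  apply (path_propagation D (fun x => f x = f p) p q Hpc Hp Hq eq_refl).
  - intros z Hz E. apply locally_Cmod. destruct (Hloc z Hz) as [d [Hd H]].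
    exists d. split; [exact Hd|]. intros x Hx. rewrite <- E. now apply H.
  - intros z Hz Hacc. destruct (Hloc z Hz) as [d [Hd H]].
    destruct (Hacc d Hd) as [x [Hx E]]. rewrite <- E. symmetry. now apply H.
Qed.

(** * The periods and their Wronskian *)

(** The hypergeometric operator [z (1 - z) f'' + (1 - 2 z) f' - (2/9) f],
    expanded into sums, scalings and multiplications by [z], the operations
    for which expansions are computed. *)
Definition gauss_op (f : C -> C) (z : C) : C :=
  (z * C_derive (C_derive f) z + C_derive f z
   + RtoC (-1) * (z * (z * C_derive (C_derive f) z))
   + RtoC (-2) * (z * C_derive f z) + RtoC (- (2/9)) * f z)%C.

Definition twice_cderivable (f : C -> C) (z : C) : Prop :=
  @ex_derive C_AbsRing C_NormedModule f z /\ @ex_derive C_AbsRing C_NormedModule (C_derive f) z.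

Lemma L_PF_gauss f z : twice_cderivable f z -> L_PF f z = (z * gauss_op f z)%C.
Proof.
  intros [H1 H2]. apply ex_cderive in H1. apply ex_cderive in H2.
  assert (Ht : is_cderive (theta f) z (1 * C_derive f z + z * C_derive (C_derive f) z)%C)
    by exact (cderive_mult _ _ _ _ _ (cderive_id z) H2).
  assert (Hp : forall k : R, is_cderive (theta_plus k f) z
     (1 * C_derive f z + z * C_derive (C_derive f) z + (0 * f z + RtoC k * C_derive f z))%C).
  { intros k. apply (cderive_plus _ _ _ _ _ Ht).
    exact (cderive_mult _ _ _ _ _ (cderive_const (RtoC k) z) H1). }
  unfold L_PF, theta_plus at 1, theta at 1, theta at 2.
  rewrite (is_C_derive_unique _ _ _ (Hp _)), (is_C_derive_unique _ _ _ Ht).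
  unfold theta_plus, theta, gauss_op.
  rewrite RtoC_opp, !RtoC_div by lra. field.
  all: intros E; injection E; lra.
Qed.

(** The Lagrange identity for the operator in self-adjoint form
    [(z (1 - z) f')' - (2/9) f]. *)
Lemma wronskian_derivative f g z : twice_cderivable f z -> twice_cderivable g z ->
  is_cderive (fun x => x * (1 - x) * wronskian f g x)%C z (gauss_op f z * g z - f z * gauss_op g z)%C.
Proof.
  intros [F1 F2] [G1 G2]. apply ex_cderive in F1, F2, G1, G2.
  assert (Hx : is_cderive (fun x => x * (1 - x))%C z (1 * (1 - z) + z * (0 - 1))%C).
  { apply (cderive_mult (fun x => x) (fun x => 1 - x)%C); [apply cderive_id|].
    apply cderive_minus; [apply cderive_const | apply cderive_id]. }
  assert (H := cderive_mult _ _ _ _ _ Hx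
    (cderive_minus _ _ _ _ _ (cderive_mult _ _ _ _ _ F2 G1) (cderive_mult _ _ _ _ _ F1 G2))).
  match type of H with is_derive _ _ ?l => replace (gauss_op f z * g z - f z * gauss_op g z)%C with l end.
  - exact H.
  - cbv beta. unfold gauss_op. rewrite RtoC_opp.
    replace (RtoC (-1)) with (- (1))%C by (now rewrite <- RtoC_opp).
    replace (RtoC (-2)) with (- (2))%C by (now rewrite <- RtoC_opp). ring.
Qed.

Lemma analytic_gauss U f : analytic_on U f -> analytic_on U (gauss_op f).
Proof.
  intros Hf. assert (H1 := analytic_derive _ _ Hf). assert (H2 := analytic_derive _ _ H1).
  assert (Hx2 := analytic_mult_id _ _ H2).
  exact (analytic_plus _ _ _ (analytic_plus _ _ _ (analytic_plus _ _ _
    (analytic_plus _ _ _ Hx2 H1)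
    (analytic_scal _ (RtoC (-1)) _ (analytic_mult_id _ _ Hx2)))
    (analytic_scal _ (RtoC (-2)) _ (analytic_mult_id _ _ H1)))
    (analytic_scal _ (RtoC (- (2/9))) _ Hf)).
Qed.

Lemma analytic_twice_cderivable U f z : analytic_on U f -> U z -> twice_cderivable f z.
Proof.
  intros Hf Hz. split; eexists; eapply analytic_cderive; try exact Hz; [exact Hf|].
  now apply analytic_derive.
Qed.

Lemma germ_derive f g p : same_germ f g p ->
  @locally C_UniformSpace p (fun x => @ex_derive C_AbsRing C_NormedModule f x) ->
  same_germ (C_derive f) (C_derive g) p.
Proof.
  intros H Hex. apply locally_locally in H.
  unfold same_germ. generalize (filter_and _ _ H Hex). apply filter_imp. intros x [Hx [l Hl]].
  rewrite (is_C_derive_unique _ _ _ Hl). symmetry. apply is_C_derive_unique.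
  now apply (cderive_ext f).
Qed.

Lemma germ_gauss f g p : same_germ f g p -> @locally C_UniformSpace p (twice_cderivable f) ->
  same_germ (C_derive f) (C_derive g) p /\ same_germ (gauss_op f) (gauss_op g) p.
Proof.
  intros H Hex.
  assert (H1 : same_germ (C_derive f) (C_derive g) p).
  { apply germ_derive; [exact H|]. revert Hex. apply filter_imp. now intros x []. }
  assert (H2 : same_germ (C_derive (C_derive f)) (C_derive (C_derive g)) p).
  { apply germ_derive; [exact H1|]. revert Hex. apply filter_imp. now intros x []. }
  split; [exact H1|].
  unfold same_germ. generalize (filter_and _ _ H (filter_and _ _ H1 H2)). apply filter_imp.
  intros x [E [E1 E2]]. unfold gauss_op. now rewrite E, E1, E2.
Qed.

Definition gauss_coef (n : nat) : R :=
  pochhammer (1/3) n * pochhammer (2/3) n / (pochhammer 1 n * INR (fact n)).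

Lemma pochhammer_pos a n : 0 < a -> 0 < pochhammer a n.
Proof.
  intros Ha. induction n as [|n IH]; simpl; [lra|].
  apply Rmult_lt_0_compat; [exact IH | generalize (pos_INR n); lra].
Qed.

Lemma gauss_coef_S n :
  (INR n + 1) ^ 2 * gauss_coef (S n) = (INR n + 1/3) * (INR n + 2/3) * gauss_coef n.
Proof.
  unfold gauss_coef. rewrite fact_simpl, mult_INR, S_INR. simpl pochhammer.
  generalize (pos_INR n) (pochhammer_pos 1 n Rlt_0_1) (INR_fact_lt_0 n). intros.
  field. repeat split; lra.
Qed.

Lemma gauss_coef_pos n : 0 < gauss_coef n.
Proof.
  unfold gauss_coef. apply Rdiv_lt_0_compat; apply Rmult_lt_0_compat;
    try (apply pochhammer_pos; lra). apply INR_fact_lt_0.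
Qed.

Lemma gauss_coef_0 : gauss_coef 0 = 1.
Proof. unfold gauss_coef. simpl. field. Qed.

Lemma gauss_coef_decr n : gauss_coef (S n) <= gauss_coef n.
Proof.
  assert (H := gauss_coef_S n). assert (Hp := gauss_coef_pos n). assert (Hn := pos_INR n).
  apply Rmult_le_reg_l with ((INR n + 1) ^ 2); [nra|]. rewrite H.
  apply Rmult_le_compat_r; [lra | nra].
Qed.

Lemma gauss_coef_le_1 n : gauss_coef n <= 1.
Proof.
  induction n as [|n IH]; [rewrite gauss_coef_0; lra|]. generalize (gauss_coef_decr n). lra.
Qed.

Definition gauss_ccoef (n : nat) : C := RtoC (gauss_coef n).

Lemma expansion_omega0 : expansion omega0 0 gauss_ccoef 1.
Proof.
  split; [lra|]. intros h Hh. rewrite Cplus_0_l.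
  change (omega0 h) with (Cpower_sum gauss_ccoef h). apply Cpower_sum_correct.
  apply Rbar_lt_le_trans with 1; [exact Hh|].
  destruct (CV_radius_bounded (fun n => Cmod (gauss_ccoef n))) as [Hub _].
  apply Hub. exists 1. intros n. unfold gauss_ccoef.
  rewrite pow1, Rmult_1_r.
  rewrite Cmod_R, Rabs_Rabsolu, Rabs_pos_eq by (apply Rlt_le, gauss_coef_pos). apply gauss_coef_le_1.
Qed.

(** The Enestrom-Kakeya argument.  At a zero [z], the series of
    [(z - 1) * omega0 z = 0] reads
    [1 = z * sum_n (c_n - c_(n+1)) * z^n], and the right-hand side has modulus
    at most [|z|], since the differences are nonnegative and telescope to at
    most [c_0 = 1]. *)
Lemma omega0_neq_0 z : Cmod z < 1 -> omega0 z <> RtoC 0.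
Proof.
  intros Hz H0.
  assert (Hs := proj2 expansion_omega0 z Hz). rewrite Cplus_0_l, H0 in Hs.
  assert (Hd := Cseries_minus _ _ _ _ (Cseries_scal z _ _ Hs) (Cseries_tail _ _ Hs)).
  assert (Hle : Cmod (RtoC 1) <= Cmod z).
  { replace (RtoC 1) with (z * 0 - (0 - gauss_ccoef 0 * z ^ 0))%C
      by (unfold gauss_ccoef; rewrite gauss_coef_0; simpl; ring).
    apply (Cseries_norm_le _ _ (fun _ => Cmod z) _ Hd); [|apply is_lim_seq_const].
    intros N. apply Rle_trans with (Cmod z * (1 - gauss_coef (S N))).
    - assert (Hterm : forall n, Cmod (z * (gauss_ccoef n * z ^ n) - gauss_ccoef (S n) * z ^ (S n))%C
                <= Cmod z * (gauss_coef n - gauss_coef (S n))).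
      { intros n. replace (z * (gauss_ccoef n * z ^ n) - gauss_ccoef (S n) * z ^ (S n))%C
          with (z * (RtoC (gauss_coef n - gauss_coef (S n)) * z ^ n))%C
          by (unfold gauss_ccoef; rewrite RtoC_minus; simpl; ring).
        assert (Hc := gauss_coef_decr n).
        rewrite !Cmod_mult, Cmod_pow, Cmod_R, Rabs_pos_eq by lra.
        apply Rmult_le_compat_l; [apply Cmod_ge_0|].
        rewrite <- (Rmult_1_r (gauss_coef n - gauss_coef (S n))) at 2.
        apply Rmult_le_compat_l; [lra|].
        rewrite <- (pow1 n). apply pow_incr. split; [apply Cmod_ge_0 | lra]. }
      induction N as [|N IH].
      + rewrite sum_O. rewrite <- gauss_coef_0 at 1. apply Hterm.
      + rewrite sum_Sn. eapply Rle_trans; [apply Rplus_le_compat; [exact IH | apply Hterm]|].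
        apply Req_le. ring.
    - generalize (gauss_coef_pos (S N)) (Cmod_ge_0 z). nra. }
  rewrite Cmod_1 in Hle. lra.
Qed.

Lemma omega0_twice_cderivable z : Cmod z < 1 -> twice_cderivable omega0 z.
Proof.
  intros Hz. rewrite <- (Cplus_0_l z).
  split; eexists; eapply expansion_cderive; try exact Hz.
  - exact expansion_omega0.
  - apply expansion_derive. exact expansion_omega0.
Qed.

(** The coefficient of [z^n] is
    [(n+1)^2 c_(n+1) - (n + 1/3) (n + 2/3) c_n], which vanishes by the
    recurrence of the Gauss series. *)
Lemma gauss_omega0 z : Cmod z < 1 -> gauss_op omega0 z = RtoC 0.
Proof.
  intros Hz.
  assert (H0 := expansion_omega0).
  assert (H1 := expansion_derive _ _ _ _ H0).
  assert (H2 := expansion_derive _ _ _ _ H1).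
  assert (Hx1 := expansion_mult_id _ _ _ _ H1).
  assert (Hx2 := expansion_mult_id _ _ _ _ H2).
  assert (Hxx := expansion_mult_id _ _ _ _ Hx2).
  assert (H := expansion_plus _ _ _ _ _ _ (expansion_plus _ _ _ _ _ _ (expansion_plus _ _ _ _ _ _
      (expansion_plus _ _ _ _ _ _ Hx2 H1) (expansion_scal (RtoC (-1)) _ _ _ _ Hxx))
      (expansion_scal (RtoC (-2)) _ _ _ _ Hx1)) (expansion_scal (RtoC (- (2/9))) _ _ _ _ H0)).
  assert (Hs := proj2 H z Hz). rewrite Cplus_0_l in Hs. fold (gauss_op omega0 z) in Hs.
  rewrite <- (Cpower_sum_unique _ _ _ Hs). apply Cpower_sum_unique.
  assert (Hz0 := Cseries_scal 0 _ _ (proj2 H0 z Hz)). rewrite Cmult_0_l in Hz0.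
  revert Hz0. apply is_series_ext. intros n.
  match goal with |- _ = (?c * _)%C => replace c with (RtoC 0); [change (0 * (gauss_ccoef n * z ^ n) = 0 * z ^ n)%C; ring|] end.
  assert (Hrec := gauss_coef_S n).
  destruct n as [|[|n]]; unfold PS_Cshift, PS_Cderive, gauss_ccoef; rewrite <- ?RtoC_mult, <- ?RtoC_plus,
    <- ?RtoC_mult, <- ?RtoC_plus, <- ?RtoC_mult, <- ?RtoC_plus,
    <- ?RtoC_mult, <- ?RtoC_plus; f_equal; rewrite !S_INR in *; simpl (INR 0) in *; lra.
Qed.

Definition lens (z : C) : Prop := punctured_disc z /\ Cmod (1 - z)%C < 1.

Lemma open_disc p : @open C_UniformSpace (fun z : C => Cmod (z - p)%C < 1).
Proof.
  intros z Hz. apply locally_Cmod. exists (1 - Cmod (z - p)%C). split; [lra|].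
  intros x Hx. replace (x - p)%C with ((x - z) + (z - p))%C by ring.
  eapply Rle_lt_trans; [apply Cmod_triangle | lra].
Qed.

Lemma Cmod_minus_sym (x y : C) : Cmod (x - y)%C = Cmod (y - x)%C.
Proof. rewrite <- Cmod_opp. f_equal. ring. Qed.

Definition omega1_factor : C := (Ci / RtoC (sqrt 3))%C.

Lemma reflected_derive (f : C -> C) k z l : is_cderive f (1 - z)%C l ->
  is_cderive (fun x => k * f (1 - x))%C z (- k * l)%C.
Proof.
  intros H.
  replace (- k * l)%C with (0 * f (1 - z) + k * ((0 - 1) * l))%C by ring.
  apply (cderive_mult (fun _ => k) (fun x => f (1 - x)%C)); [apply cderive_const|].
  apply (cderive_comp f (fun x => 1 - x)%C); [exact H|].
  apply cderive_minus; [apply cderive_const | apply cderive_id].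
Qed.

Lemma omega1_series_derive z : Cmod (1 - z)%C < 1 ->
  C_derive omega1_series z = (- omega1_factor * C_derive omega0 (1 - z))%C /\
  C_derive (C_derive omega1_series) z = (omega1_factor * C_derive (C_derive omega0) (1 - z))%C /\
  twice_cderivable omega1_series z.
Proof.
  assert (H1 : forall x : C, Cmod (1 - x)%C < 1 -> is_cderive omega1_series x (- omega1_factor * C_derive omega0 (1 - x))%C).
  { intros x Hx. apply (reflected_derive omega0). apply ex_cderive. now apply omega0_twice_cderivable. }
  intros Hz.
  assert (H2 : is_cderive (C_derive omega1_series) z (- - omega1_factor * C_derive (C_derive omega0) (1 - z))%C).
  { apply cderive_ext with (fun x => - omega1_factor * C_derive omega0 (1 - x))%C.
    - rewrite Cmod_minus_sym in Hz. generalize (open_disc 1 z Hz). apply filter_imp.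
      intros x Hx. rewrite Cmod_minus_sym in Hx. symmetry. apply is_C_derive_unique. now apply H1.
    - apply reflected_derive. apply ex_cderive. now apply omega0_twice_cderivable. }
  assert (H1z := H1 z Hz).
  split; [exact (is_C_derive_unique _ _ _ H1z)|].
  split; [|split; eexists; [exact H1z | exact H2]].
  rewrite (is_C_derive_unique _ _ _ H2). ring.
Qed.

(** The operator is invariant under the reflection [z |-> 1 - z]. *)
Lemma gauss_omega1_series z : Cmod (1 - z)%C < 1 -> gauss_op omega1_series z = RtoC 0.
Proof.
  intros Hz. destruct (omega1_series_derive z Hz) as [E1 [E2 _]].
  assert (H := gauss_omega0 (1 - z)%C Hz).
  rewrite <- (Cmult_0_r omega1_factor), <- H. unfold gauss_op. rewrite E1, E2.
  change (omega1_series z) with (omega1_factor * omega0 (1 - z))%C.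
  replace (RtoC (-1)) with (- (1))%C by (now rewrite <- RtoC_opp).
  replace (RtoC (-2)) with (- (2))%C by (now rewrite <- RtoC_opp). ring.
Qed.

(** The value of [z (1 - z) W(z)] at [z = 1/2], the fixed point of the
    reflection, where both terms of the Wronskian coincide. *)
Definition wronskian_constant : C :=
  (/ 2 * omega1_factor * C_derive omega0 (/ 2) * omega0 (/ 2))%C.

(** The derived series has positive coefficients and a positive argument. *)
Lemma omega0_derive_half_neq_0 : C_derive omega0 (/ 2)%C <> RtoC 0.
Proof.
  intros E.
  assert (Hh : (/ 2)%C = RtoC (/ 2)) by (symmetry; apply RtoC_inv; lra).
  assert (Hlt : Cmod (RtoC (/ 2)) < 1) by (rewrite Cmod_R, Rabs_pos_eq; lra).
  assert (H := proj2 (expansion_derive _ _ _ _ expansion_omega0) _ Hlt).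
  rewrite Cplus_0_l, <- Hh, E in H. apply Cseries_pair in H. destruct H as [H _].
  assert (Hterm : forall n, Re (PS_Cderive gauss_ccoef n * (/ 2) ^ n)%C = INR (S n) * gauss_coef (S n) * (/ 2) ^ n).
  { intros n. unfold PS_Cderive, gauss_ccoef. rewrite Hh, <- RtoC_pow, <- !RtoC_mult. reflexivity. }
  apply (Rlt_irrefl 0). apply Rlt_le_trans with (gauss_coef 1); [apply gauss_coef_pos|].
  refine (is_lim_seq_le (fun _ => gauss_coef 1) _ (gauss_coef 1) 0 _ (is_lim_seq_const _) H).
  intros N. induction N as [|N IH].
  - rewrite sum_O, Hterm. simpl. lra.
  - rewrite sum_Sn, Hterm. apply Rle_trans with (1 := IH).
    assert (H0 : 0 <= INR (S (S N)) * gauss_coef (S (S N)) * (/ 2) ^ (S N)).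
    { apply Rmult_le_pos; [apply Rmult_le_pos|];
        [apply pos_INR | apply Rlt_le, gauss_coef_pos | apply pow_le; lra]. }
    exact (Rle_trans _ _ _ (Req_le _ _ (eq_sym (Rplus_0_r _))) (Rplus_le_compat_l _ _ _ H0)).
Qed.

Lemma Cmod_half : Cmod (/ 2)%C = / 2.
Proof. rewrite <- RtoC_inv, Cmod_R, Rabs_pos_eq by lra. reflexivity. Qed.

Lemma omega1_factor_neq_0 : omega1_factor <> RtoC 0.
Proof.
  unfold omega1_factor. assert (H3 := sqrt_lt_R0 3 ltac:(lra)).
  intros E. assert (Ci = RtoC 0).
  { replace Ci with (Ci / RtoC (sqrt 3) * RtoC (sqrt 3))%C; [rewrite E; ring|].
    field. intros E2. injection E2. lra. }
  injection H. lra.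
Qed.

Lemma wronskian_constant_neq_0 : wronskian_constant <> RtoC 0.
Proof.
  unfold wronskian_constant. apply Cmult_neq_0; [apply Cmult_neq_0; [apply Cmult_neq_0|]|].
  - intros E. assert (H := Cmod_half). rewrite E, Cmod_0 in H. lra.
  - apply omega1_factor_neq_0.
  - apply omega0_derive_half_neq_0.
  - apply omega0_neq_0. rewrite Cmod_half. lra.
Qed.

(** The lens is convex and contains [1/2], so the constant can be transported
    along a segment. *)
Lemma lens_wronskian p :
  lens p -> (p * (1 - p) * wronskian omega0 omega1_series p = wronskian_constant)%C.
Proof.
  intros [[_ Hp1] Hp2].
  rewrite (cderive_0_segment (fun x => x * (1 - x) * wronskian omega0 omega1_series x)%C (/ 2)%C p).
  - assert (Hh : (1 - / 2 = / 2)%C).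
    { field. }
    destruct (omega1_series_derive (/ 2)%C) as [E1 _].
    { rewrite Hh, Cmod_half. lra. }
    unfold wronskian. rewrite E1.
    change (omega1_series (/ 2)) with (omega1_factor * omega0 (1 - / 2))%C. rewrite !Hh.
    unfold wronskian_constant. field.
  - intros t Ht.
    set (x := (/ 2 + RtoC t * (p - / 2))%C).
    assert (Hconv : forall u v : C, Cmod u <= / 2 -> Cmod v < 1 ->
      Cmod (RtoC (1 - t) * u + RtoC t * v)%C < 1).
    { intros u v Hu Hv. eapply Rle_lt_trans; [apply Cmod_triangle|].
      rewrite !Cmod_mult, !Cmod_R, !Rabs_pos_eq by lra.
      generalize (Cmod_ge_0 u) (Cmod_ge_0 v). nra. }
    assert (Hx1 : Cmod x < 1).
    { replace x with (RtoC (1 - t) * / 2 + RtoC t * p)%C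
        by (unfold x; rewrite RtoC_minus; ring).
      apply Hconv; [rewrite Cmod_half; lra | exact Hp1]. }
    assert (Hx2 : Cmod (1 - x)%C < 1).
    { replace (1 - x)%C with (RtoC (1 - t) * / 2 + RtoC t * (1 - p))%C.
      - apply Hconv; [rewrite Cmod_half; lra | exact Hp2].
      - unfold x; rewrite RtoC_minus. field. }
    replace (RtoC 0) with (gauss_op omega0 x * omega1_series x - omega0 x * gauss_op omega1_series x)%C
      by (rewrite gauss_omega0, gauss_omega1_series by assumption; ring).
    apply wronskian_derivative.
    + now apply omega0_twice_cderivable.
    + now apply omega1_series_derive.
Qed.

Lemma open_lens : @open C_UniformSpace (fun x => Cmod x < 1 /\ Cmod (1 - x)%C < 1).
Proof.
  assert (E : forall x : C, (x - 0)%C = x) by (intros; ring).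
  intros z [H1 H2]. rewrite <- (E z) in H1. rewrite Cmod_minus_sym in H2.
  generalize (filter_and _ _ (open_disc 0 z H1) (open_disc 1 z H2)). apply filter_imp.
  intros x. now rewrite E, (Cmod_minus_sym x).
Qed.

Definition normalized_solution (V : C -> Prop) (g : C -> C) : Prop :=
  forall z, V z -> gauss_op g z = RtoC 0 /\ (z * (1 - z) * wronskian omega0 g z = wronskian_constant)%C.

(** Both conclusions are identities between analytic functions; the second one
    follows from the first, because it makes the derivative of
    [z (1 - z) W] zero. *)
Lemma solution_propagation V g p : is_domain V -> (forall z, V z -> punctured_disc z) ->
  analytic_on V g -> V p ->
  @locally C_UniformSpace p (fun x => gauss_op g x = RtoC 0) ->
  (p * (1 - p) * wronskian omega0 g p = wronskian_constant)%C ->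
  normalized_solution V g.
Proof.
  intros HV Hsub Hg Hp Hloc HK.
  assert (Hgz : forall z, V z -> gauss_op g z = RtoC 0).
  { apply (identity_theorem V (gauss_op g) p HV); [now apply analytic_gauss | exact Hp | exact Hloc]. }
  intros z Hz. split; [now apply Hgz|].
  rewrite <- HK. apply (cderive_0_constant V (fun x => x * (1 - x) * wronskian omega0 g x)%C p z HV); trivial.
  intros x Hx. destruct (Hsub x Hx) as [_ Hx1].
  replace (RtoC 0) with (gauss_op omega0 x * g x - omega0 x * gauss_op g x)%C
    by (rewrite gauss_omega0, Hgz by assumption; ring).
  apply wronskian_derivative; [now apply omega0_twice_cderivable | now apply (analytic_twice_cderivable V)].
Qed.

Lemma germ_propagation V f g p : is_domain V -> (forall z, V z -> punctured_disc z) ->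
  analytic_on V g -> V p -> same_germ f g p ->
  @locally C_UniformSpace p (twice_cderivable f) ->
  @locally C_UniformSpace p (fun x => gauss_op f x = RtoC 0) ->
  (p * (1 - p) * wronskian omega0 f p = wronskian_constant)%C ->
  normalized_solution V g.
Proof.
  intros HV Hsub Hg Hp Hfg Hf Hgf HK.
  destruct (germ_gauss _ _ _ Hfg Hf) as [H1 H2].
  apply (solution_propagation V g p HV Hsub Hg Hp).
  - unfold same_germ in H2. generalize (filter_and _ _ H2 Hgf). apply filter_imp.
    intros x [<- E]. exact E.
  - rewrite <- HK. unfold wronskian.
    rewrite (locally_singleton _ _ Hfg), (locally_singleton _ _ H1). reflexivity.
Qed.

(** Induction on the chain of continuations: the common germ carries both
    properties from one function element to the next. *)
Lemma omega1_properties D omega1 : is_omega1 D omega1 ->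
  is_domain D /\ analytic_on D omega1 /\ (forall z, D z -> punctured_disc z) /\ normalized_solution D omega1.
Proof.
  unfold is_omega1.
  induction 1 as [V g HV Hsub Hg [p [Hp [HVp Hgerm]]] | V V' g g' _ [HV [Hg [Hs IH]]] HV' Hsub Hg' [p [HVp [HVp' Hgerm]]]].
  - split; [exact HV|]. split; [exact Hg|]. split; [exact Hsub|].
    apply (germ_propagation V omega1_series g p HV Hsub Hg HVp Hgerm).
    + generalize (open_lens p (conj (proj2 (proj1 Hp)) (proj2 Hp))). apply filter_imp.
      intros x [_ Hx]. now apply omega1_series_derive.
    + generalize (open_lens p (conj (proj2 (proj1 Hp)) (proj2 Hp))). apply filter_imp.
      intros x [_ Hx]. now apply gauss_omega1_series.
    + now apply lens_wronskian.
  - split; [exact HV'|]. split; [exact Hg'|]. split; [exact Hsub|].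
    assert (HpV := proj1 (proj2 HV) p HVp).
    apply (germ_propagation V' g g' p HV' Hsub Hg' HVp' Hgerm).
    + revert HpV. apply filter_imp. intros x Hx. now apply (analytic_twice_cderivable V).
    + revert HpV. apply filter_imp. intros x Hx. now apply IH.
    + now apply IH.
Qed.

(** * Solutions of the GKZ equation *)

Lemma theta_cderive f z : twice_cderivable f z ->
  is_cderive (theta f) z (C_derive f z + z * C_derive (C_derive f) z)%C.
Proof.
  intros [_ H]. apply ex_cderive in H.
  rewrite <- (Cmult_1_l (C_derive f z)) at 1.
  exact (cderive_mult _ _ _ _ _ (cderive_id z) H).
Qed.

(** Away from the origin, [f' = theta f / z] inherits the differentiability of
    [theta f]. *)
Lemma GKZ_twice_cderivable D f z : @open C_UniformSpace D -> (forall x, D x -> x <> RtoC 0) ->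
  GKZ_solution D f -> D z -> twice_cderivable f z.
Proof.
  intros HD H0 [Hf _] Hz. destruct (Hf z Hz) as [H1 [H2 _]]. split; [exact H1|].
  eexists. apply cderive_ext with (fun x => theta f x / x)%C.
  - generalize (HD z Hz). apply filter_imp. intros x Hx. unfold theta. field. now apply H0.
  - apply (cderive_div (theta f) (fun x => x)); [now apply H0 | apply ex_cderive, H2 | apply cderive_id].
Qed.

(** The function [L_PF f] has zero derivative.  Its differentiability is read
    off from the form [(1 - z) theta^2 f - z theta f - (2/9) z f]. *)
Lemma GKZ_first_integral D f : is_domain D -> (forall x, D x -> x <> RtoC 0) ->
  GKZ_solution D f -> exists k, forall z, D z -> (z * gauss_op f z)%C = k.
Proof.
  intros HD H0 Hf. destruct (proj1 HD) as [p Hp]. assert (HDo := proj1 (proj2 HD)).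
  assert (Htw : forall z, D z -> twice_cderivable f z) by (intros z; now apply GKZ_twice_cderivable).
  exists (p * gauss_op f p)%C. intros z Hz.
  rewrite <- (L_PF_gauss f z), <- (L_PF_gauss f p) by now apply Htw.
  apply (cderive_0_constant D (L_PF f) p z HD); trivial.
  clear z Hz. intros z Hz.
  destruct Hf as [Hf Heq]. destruct (Hf z Hz) as [H1 [H2 H3]].
  apply ex_cderive in H1, H2, H3.
  assert (Hex : @ex_derive C_AbsRing C_NormedModule (L_PF f) z).
  { eexists. apply cderive_ext with (fun x => (1 - x) * theta (theta f) x - x * theta f x - x * (RtoC (2/9) * f x))%C.
    - generalize (HDo z Hz). apply filter_imp. intros x Hx.
      rewrite (L_PF_gauss f x) by now apply Htw.
      unfold theta at 1. rewrite (is_C_derive_unique _ _ _ (theta_cderive f x (Htw x Hx))).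
      unfold theta, gauss_op. rewrite RtoC_opp.
      replace (RtoC (-1)) with (- (1))%C by (now rewrite <- RtoC_opp).
      replace (RtoC (-2)) with (- (2))%C by (now rewrite <- RtoC_opp). ring.
    - apply (cderive_minus (fun x => (1 - x) * theta (theta f) x - x * theta f x)%C).
      + apply (cderive_minus (fun x => (1 - x) * theta (theta f) x)%C).
        * apply (cderive_mult (fun x => 1 - x)%C); [|exact H3].
          apply cderive_minus; [apply cderive_const | apply cderive_id].
        * apply (cderive_mult (fun x => x)); [apply cderive_id | exact H2].
      + apply (cderive_mult (fun x => x)); [apply cderive_id|].
        apply (cderive_mult (fun _ => RtoC (2/9))); [apply cderive_const | exact H1]. }
  apply ex_cderive in Hex.
  replace (RtoC 0) with (C_derive (L_PF f) z); [exact Hex|].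
  assert (E0 := Heq z Hz). unfold theta in E0. apply H0 in Hz.
  replace (C_derive (L_PF f) z) with (/ z * (z * C_derive (L_PF f) z))%C by (field; exact Hz).
  rewrite E0. ring.
Qed.

Lemma ratio_derive f z : Cmod z < 1 -> twice_cderivable f z ->
  is_cderive (fun x => f x / omega0 x)%C z (wronskian f omega0 z / (omega0 z * omega0 z))%C.
Proof.
  intros Hz [H _]. destruct (omega0_twice_cderivable z Hz) as [H0 _].
  apply cderive_div; [now apply omega0_neq_0 | now apply ex_cderive | now apply ex_cderive].
Qed.

Lemma punctured_disc_neq z : punctured_disc z -> z <> RtoC 0 /\ (1 - z)%C <> RtoC 0.
Proof.
  intros [H0 H1]. split.
  - now apply Cmod_gt_0.
  - intros E. replace z with (1 - (1 - z))%C in H1 by ring.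
    rewrite E in H1. replace (1 - 0)%C with (RtoC 1) in H1 by ring.
    rewrite Cmod_1 in H1. lra.
Qed.

(** The derivative of [f / omega0] with respect to [tau]: this is the quotient
    of [(f / omega0)'] by [tau' = - W / omega0^2], with [W] replaced by its
    value [wronskian_constant / (z (1 - z))]. *)
Definition slope (f : C -> C) (z : C) : C :=
  (/ - wronskian_constant * (z * (1 - z) * wronskian f omega0 z))%C.

(** The Lagrange identity, with [gauss_op omega0 = 0] and
    [gauss_op f = k / z]. *)
Lemma slope_derive f k z :
  punctured_disc z -> twice_cderivable f z -> (z * gauss_op f z)%C = k ->
  is_cderive (slope f) z (- k * (omega0 z / (wronskian_constant * z)))%C.
Proof.
  intros Hz Hf Hk. destruct (punctured_disc_neq z Hz) as [Hz0 _]. destruct Hz as [_ Hz1].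
  assert (HK := wronskian_constant_neq_0).
  assert (H := cderive_mult _ _ _ _ _ (cderive_const (/ - wronskian_constant)%C z)
    (wronskian_derivative f omega0 z Hf (omega0_twice_cderivable z Hz1))).
  match type of H with is_derive _ _ ?l => replace (- k * (omega0 z / (wronskian_constant * z)))%C with l end.
  - exact H.
  - cbv beta. rewrite gauss_omega0 by exact Hz1. rewrite <- Hk. field. tauto.
Qed.

(** The identity [dt = slope * dtau], for any companion [w] of [omega0] with
    the right Wronskian. *)
Lemma slope_spec f w z :
  punctured_disc z -> (z * (1 - z) * wronskian omega0 w z)%C = wronskian_constant ->
  (wronskian f omega0 z / (omega0 z * omega0 z) = slope f z * (wronskian w omega0 z / (omega0 z * omega0 z)))%C.
Proof.
  intros Hz HK. assert (H0 := wronskian_constant_neq_0). assert (Hw := omega0_neq_0 z (proj2 Hz)).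
  replace (wronskian w omega0 z) with (- wronskian omega0 w z)%C by (unfold wronskian; ring).
  unfold slope. rewrite <- HK in *.
  assert (wronskian omega0 w z <> RtoC 0).
  { intros E. apply H0. rewrite E. ring. }
  field. destruct (punctured_disc_neq z Hz). repeat split; assumption.
Qed.

Theorem corollary3p2 (D : C -> Prop) (omega1 I : C -> C)
    (HD : simply_connected_domain D)
    (HD0 : forall z : C, D z -> punctured_disc z)
    (Homega1 : is_omega1 D omega1)
    (HI : GKZ_solution D I) :
  let tau := fun z : C => (omega1 z / omega0 z)%C in
  let W := wronskian omega0 omega1 in
  let t_GKZ := fun z : C => (I z / omega0 z)%C in
  (exists c : C, forall z0 : C, D z0 -> exists a b : C,
     forall (z : C) (g dg : R -> C), C1_path D g dg z0 z ->
     exists J : C,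
       is_path_integral
         (fun v : C => (1 / (v ^ 2 * (1 - v)) * (1 / W v)
                        * omega0 v * (tau z - tau v))%C) g dg J /\
       t_GKZ z = (a + b * tau z + c * J)%C)
  /\
  (forall (T : C -> Prop) (alpha : C -> C), tau_coordinate D tau T alpha ->
   exists c : C, forall s0 : C, T s0 -> exists a b : C,
     forall (s : C) (g dg : R -> C), C1_path T g dg s0 s ->
     exists J : C,
       is_path_integral
         (fun v : C => ((1 - alpha v) * omega0 (alpha v) ^ 3 * (s - v))%C)
         g dg J /\
       t_GKZ (alpha s) = (a + b * s + c * J)%C).
Proof.
  intros tau W t.
  destruct (omega1_properties D omega1 Homega1) as [Hdom [Han [_ Hsol]]].
  assert (HDo : @open C_UniformSpace D) by apply Hdom.
  assert (Hnz : forall z, D z -> z <> RtoC 0 /\ (1 - z)%C <> RtoC 0 /\ omega0 z <> RtoC 0 /\ W z <> RtoC 0).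
  { intros z Hz. destruct (punctured_disc_neq z (HD0 z Hz)) as [H1 H2].
    repeat split; trivial.
    - apply omega0_neq_0. apply HD0, Hz.
    - intros E. apply wronskian_constant_neq_0. rewrite <- (proj2 (Hsol z Hz)). fold W. rewrite E. ring. }
  destruct (GKZ_first_integral D I Hdom (fun z Hz => proj1 (Hnz z Hz)) HI) as [k Hk].
  assert (HIt : forall z, D z -> twice_cderivable I z).
  { intros z. apply (GKZ_twice_cderivable D I z HDo); [intros x Hx; now apply Hnz | exact HI]. }
  assert (Hw0 : forall z, D z -> is_cderive omega0 z (C_derive omega0 z)).
  { intros z Hz. apply ex_cderive. apply omega0_twice_cderivable. apply HD0, Hz. }
  set (dtau := fun z => (- W z / (omega0 z * omega0 z))%C).
  assert (Htau : forall z, D z -> is_cderive tau z (dtau z)).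
  { intros z Hz. replace (dtau z) with (wronskian omega1 omega0 z / (omega0 z * omega0 z))%C.
    - apply ratio_derive; [apply HD0, Hz | now apply (analytic_twice_cderivable D)].
    - unfold dtau, W, wronskian. f_equal. ring. }
  assert (Ht : forall z, D z -> is_cderive t z (slope I z * dtau z)%C).
  { intros z Hz. replace (slope I z * dtau z)%C with (wronskian I omega0 z / (omega0 z * omega0 z))%C.
    - apply ratio_derive; [apply HD0, Hz | now apply HIt].
    - rewrite (slope_spec I omega1 z (HD0 z Hz) (proj2 (Hsol z Hz))).
      unfold dtau, W, wronskian. f_equal. f_equal. ring. }
  assert (Hslope : forall z, D z -> is_cderive (slope I) z (- k * (omega0 z / (wronskian_constant * z)))%C).
  { intros z Hz. apply slope_derive; [now apply HD0 | now apply HIt | now apply Hk]. }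
  split.
  - (* Here and below, [a] and [b] come from the increment of
       [slope * (tau z - tau v) + t] between the end points. *)
    exists (- k)%C. intros z0 Hz0. exists (t z0 - slope I z0 * tau z0)%C, (slope I z0).
    intros z g dg Hg.
    assert (Hker : forall v, D v -> (1 / (v ^ 2 * (1 - v)) * (1 / W v) * omega0 v * (tau z - tau v)
                     = omega0 v / (wronskian_constant * v) * (tau z - tau v))%C).
    { intros v Hv. rewrite <- (proj2 (Hsol v Hv)). fold W. destruct (Hnz v Hv) as [N1 [N2 [N3 N4]]].
      field. repeat split; assumption. }
    destruct (path_integral_primitive D (fun v => slope I v * (tau z - tau v) + t v)%C
      (fun v => 1 / (v ^ 2 * (1 - v)) * (1 / W v) * omega0 v * (tau z - tau v))%C (- k) z0 z g dg Hg)
      as [J [HJ EJ]].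
    + intros v Hv. rewrite (Hker v Hv).
      replace (- k * (omega0 v / (wronskian_constant * v) * (tau z - tau v)))%C with
        (- k * (omega0 v / (wronskian_constant * v)) * (tau z - tau v) + slope I v * (0 - dtau v) + slope I v * dtau v)%C by ring.
      apply (cderive_plus (fun v => slope I v * (tau z - tau v))%C t); [|now apply Ht].
      apply (cderive_mult (slope I) (fun v => tau z - tau v)%C); [now apply Hslope|].
      apply cderive_minus; [apply cderive_const | now apply Htau].
    + intros v Hv. destruct (Hnz v Hv) as [N1 _].
      eexists. apply cderive_ext with (fun v => omega0 v / (wronskian_constant * v) * (tau z - tau v))%C.
      * generalize (HDo v Hv). apply filter_imp. intros x Hx. symmetry. now apply Hker.
      * apply (cderive_mult (fun v => omega0 v / (wronskian_constant * v))%C (fun v => tau z - tau v)%C).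
        -- apply (cderive_div omega0 (fun v => wronskian_constant * v)%C).
           ++ apply Cmult_neq_0; [apply wronskian_constant_neq_0 | exact N1].
           ++ now apply Hw0.
           ++ apply (cderive_mult (fun _ => wronskian_constant) (fun v => v)); [apply cderive_const | apply cderive_id].
        -- apply cderive_minus; [apply cderive_const | now apply Htau].
    + exists J. split; [exact HJ|]. rewrite EJ. ring.
  - intros T alpha [HT Ha]. assert (HK := wronskian_constant_neq_0).
    (* [alpha] is a local inverse of [tau], so its derivative is [1 / tau']. *)
    assert (Halpha : forall v, T v -> is_cderive alpha v (/ dtau (alpha v))%C).
    { intros v Hv. destruct (Ha v Hv) as [HDv [_ Hex]]. apply ex_cderive in Hex.
      assert (Hc := cderive_comp tau alpha v _ _ (Htau _ HDv) Hex).
      assert (Hid : is_cderive (fun x => tau (alpha x)) v (RtoC 1)).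
      { apply cderive_ext with (fun x => x); [|apply cderive_id].
        generalize (proj1 (proj2 HT) v Hv). apply filter_imp.
        intros x Hx. symmetry. now apply Ha. }
      apply is_C_derive_unique in Hid. rewrite (is_C_derive_unique _ _ _ Hc) in Hid.
      replace (/ dtau (alpha v))%C with (C_derive alpha v); [exact Hex|].
      assert (Hd : dtau (alpha v) <> RtoC 0).
      { intros E. rewrite E, Cmult_0_r in Hid. injection Hid. lra. }
      rewrite <- (Cmult_1_l (/ _)), <- Hid. field. exact Hd. }
    exists (k / (wronskian_constant * wronskian_constant))%C. intros s0 Hs0.
    exists (t (alpha s0) - slope I (alpha s0) * s0)%C, (slope I (alpha s0)).
    intros s g dg Hg.
    destruct (path_integral_primitive T (fun v => slope I (alpha v) * (s - v) + t (alpha v))%C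
      (fun v => (1 - alpha v) * omega0 (alpha v) ^ 3 * (s - v))%C (k / (wronskian_constant * wronskian_constant)) s0 s g dg Hg)
      as [J [HJ EJ]].
    + intros v Hv. destruct (Ha v Hv) as [HDv [_ _]].
      destruct (Hnz _ HDv) as [N1 [N2 [N3 N4]]].
      assert (Hsl := cderive_comp _ _ _ _ _ (Hslope _ HDv) (Halpha v Hv)).
      assert (Hta := cderive_comp _ _ _ _ _ (Ht _ HDv) (Halpha v Hv)).
      assert (H := cderive_plus _ _ _ _ _ (cderive_mult _ _ _ _ _ Hsl
                (cderive_minus _ _ _ _ _ (cderive_const s v) (cderive_id v))) Hta).
      match type of H with is_derive _ _ ?l =>
        replace (k / (wronskian_constant * wronskian_constant) * ((1 - alpha v) * omega0 (alpha v) ^ 3 * (s - v)))%C with l end.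
      * exact H.
      * cbv beta. unfold dtau. rewrite <- (proj2 (Hsol _ HDv)) in *. fold W.
        field. repeat split; assumption.
    + intros v Hv. destruct (Ha v Hv) as [HDv [_ _]].
      assert (Hw := cderive_comp _ _ _ _ _ (Hw0 _ HDv) (Halpha v Hv)).
      eexists.
      apply (cderive_mult (fun v => (1 - alpha v) * omega0 (alpha v) ^ 3)%C (fun v => s - v)%C).
      * apply (cderive_mult (fun v => 1 - alpha v)%C (fun v => omega0 (alpha v) ^ 3)%C).
        -- apply cderive_minus; [apply cderive_const | now apply Halpha].
        -- exact (cderive_mult _ _ _ _ _ Hw (cderive_mult _ _ _ _ _ Hw
             (cderive_mult _ _ _ _ _ Hw (cderive_const 1 v)))).
      * apply cderive_minus; [apply cderive_const | apply cderive_id].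
    + exists J. split; [exact HJ|]. rewrite EJ. cbv beta. ring.
Qed.
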